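(* The following statements are equivalent: (i) Every finite sticky matroid is modular. (ii) Every finite hypermodular matroid is embeddable in a modular matroid. (iii) Every finite OTE matroid is modular.
   Context: A pair $(X,Y)$ of flats of a matroid with rank function $\operatorname{rk}$ is modular if $\operatorname{rk}(X)+\operatorname{rk}(Y)=\operatorname{rk}(X\cup Y)+\operatorname{rk}(X\cap Y)$. A matroid is modular if every pair of flats is modular, and hypermodular if every pair of hyperplanes is modular. A matroid $M$ embeds in $N$ if $M$ is (isomorphic to) a restriction of $N$. An extension of $M$ on $E$ is a matroid $N$ on $F\supseteq E$ with $N|E=M$; for extensions $N_1,N_2$ on $F_1,F_2$ with $F_1\cap F_2=E$, an amalgam is a matroid on $F_1\cup F_2$ restricting to $N_i$ on $F_i$; $M$ is sticky if such an amalgam exists for every such pair. A modular cut of $M$ is a set $\mathcal{M}$ of flats closed under taking flat supersets and such that $F_1\cap F_2\in\mathcal{M}$ whenever $F_1,F_2\in\mathcal{M}$ form a modular pair; it is principal if it equals $\{G\text{ flat}: G\supseteq F\}$ for some flat $F$. $M$ is OTE if every nonempty modular cut is principal. *)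

(* Defs.v *)
From mathcomp Require Import all_boot.
From mathcomp Require Import boolp classical_sets functions cardinality.

Set Implicit Arguments.
Unset Strict Implicit.
Unset Printing Implicit Defensive.

Local Open Scope classical_set_scope.
Local Open Scope card_scope.

(* A matroid of finite rank on a ground set of arbitrary cardinality, given by
   its rank function. The values of [rk] at sets that are not contained in
   [ground] are irrelevant. When [ground] is finite, [rk_finitary] is vacuous
   and the other three axioms are the usual rank axioms. *)
Record matroid (T : Type) := Matroid {
  ground : set T;
  rk : set T -> nat;
  rk_card : forall (X : set T) (n : nat),
    X `<=` ground -> X #<= `I_n -> rk X <= n;
  rk_mono : forall X Y : set T,
    X `<=` Y -> Y `<=` ground -> rk X <= rk Y;
  rk_submod : forall X Y : set T,
    X `<=` ground -> Y `<=` ground ->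
    rk (X `|` Y) + rk (X `&` Y) <= rk X + rk Y;
  rk_finitary : forall X : set T,
    X `<=` ground -> exists Y, [/\ finite_set Y, Y `<=` X & rk Y = rk X]
}.

Section Matroid.
Variables (T : Type) (M : matroid T).

Definition finite_matroid : Prop := finite_set (ground M).

Definition flat (F : set T) : Prop :=
  F `<=` ground M /\
  forall e, ground M e -> ~ F e -> rk M F < rk M (F `|` [set e]).

Definition hyperplane (H : set T) : Prop :=
  flat H /\ (rk M H).+1 = rk M (ground M).

Definition modular_pair (X Y : set T) : Prop :=
  rk M X + rk M Y = rk M (X `|` Y) + rk M (X `&` Y).

Definition modular : Prop :=
  forall X Y, flat X -> flat Y -> modular_pair X Y.

Definition hypermodular : Prop :=
  forall X Y, hyperplane X -> hyperplane Y -> modular_pair X Y.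

Definition modular_cut (C : set (set T)) : Prop :=
  [/\ forall F, C F -> flat F,
      forall F G, C F -> flat G -> F `<=` G -> C G &
      forall F G, C F -> C G -> modular_pair F G -> C (F `&` G)].

Definition principal (C : set (set T)) : Prop :=
  exists2 F, flat F & C = [set G | flat G /\ F `<=` G].

Definition OTE : Prop :=
  forall C, modular_cut C -> C !=set0 -> principal C.

End Matroid.

(* [N | ground M = M]; equivalently, N is an extension of M. *)
Definition restricts_to (T : Type) (N M : matroid T) : Prop :=
  ground M `<=` ground N /\
  forall X, X `<=` ground M -> rk N X = rk M X.

Definition isomorphic (T U : Type) (M : matroid T) (N : matroid U) : Prop :=
  exists2 f : T -> U, set_bij (ground M) (ground N) f &
    forall X, X `<=` ground M -> rk N (f @` X) = rk M X.

Definition embeds (T U : Type) (M : matroid T) (N : matroid U) : Prop :=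
  exists2 N' : matroid U, restricts_to N N' & isomorphic M N'.

Definition amalgam (T : Type) (N1 N2 N : matroid T) : Prop :=
  [/\ ground N = ground N1 `|` ground N2,
      restricts_to N N1 & restricts_to N N2].

(* The type T may have no elements outside [ground M], so the extensions are
   taken of the isomorphic copies of M over all types. *)
Definition sticky (T : Type) (M : matroid T) : Prop :=
  forall (U : Type) (M' N1 N2 : matroid U),
    isomorphic M M' ->
    restricts_to N1 M' -> restricts_to N2 M' ->
    ground N1 `&` ground N2 = ground M' ->
    exists N : matroid U, amalgam N1 N2 N.

(* Main.v *)
Require Import Defs.
From mathcomp Require Import all_boot.
From mathcomp Require Import boolp classical_sets functions cardinality.
From mathcomp Require Import zify.

(** Write H4 for: every finite OTE matroid of rank 4 is modular.

    OTE matroids are hypermodular, since a non-modular pair of hyperplanes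
    X, Y gives the non-principal cut {X, Y, ground set}; and an OTE matroid that
    embeds in a modular one is modular, since a missing intersection point
    would define a non-principal cut. Hence (ii) implies (iii).

    (ii) implies (i): if flats X, Y of M meet in a larger set Q in some
    extension of M, then another extension is incompatible with it, so M is
    not sticky. For hyperplanes such a Q can be added freely, so sticky matroids
    are hypermodular; for a matroid inside a modular one Q is already there.

    (i) implies H4, because an OTE matroid of rank 4 is sticky: the proper
    amalgam of any two extensions exists. If its rank function failed to be
    submodular, the flats sharing maximal connectivity with a suitable set
    would form a non-principal modular cut.

    H4 implies (ii): in a hypermodular matroid M take the hyperplanes as
    points and the flats of corank 2 as lines. If this linear space is
    projective, then the extension of M obtained by adding all missing points,
    without creating new hyperplanes, is modular. Projectivity is
    proved by induction on the rank. In rank 4 every non-principal modular cut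
    gives such a missing point, so the completed matroid is OTE and H4 applies; in
    rank at least 5 the Veblen-Young axiom follows, as shown by Kantor, from
    the same axiom in the contractions at single elements. *)

Set Implicit Arguments.
Unset Strict Implicit.
Unset Printing Implicit Defensive.

Local Open Scope classical_set_scope.
Local Open Scope card_scope.

(** * Closure, flats and hyperplanes *)


(** Rank 4 is the pivot for two independent reasons. In a hypermodular matroid of rank 4 a
    non-modular pair of flats has defect exactly 1 and an intersection of rank 0, so a failure of
    submodularity in the amalgam leaves no slack anywhere. On the dual side, the Veblen-Young axiom
    holds by counting up to rank 3, and from rank 5 on any four elements lie in a hyperplane, which
    is the room that Kantor's argument needs. All extensions come from one construction: for a
    quotient of corank at most m, add m elements that are as free as possible among those whose
    contraction induces the quotient. The quotients used are those of a partition, of an element and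
    of a modular cut. Completing a hypermodular matroid must terminate and must keep its dual
    geometry. Hence only cuts that create no hyperplanes are used; they correspond to sets of
    hyperplanes meeting every dual line. To refute a non-modular pair of flats X, Y one therefore
    needs such a set that contains all hyperplanes above X or above Y but misses one above X ∩ Y. It
    is obtained as a maximal subspace, which is a hyperplane of the dual projective space. *)

Ltac spec_at x :=
  repeat match goal with
  | H : @subset _ _ _ |- _ => let K := fresh "K" in pose proof (H x) as K; clear H
  end.

Ltac sset :=
  let x := fresh "x" in
  first [apply/seteqP; split => x | move=> x]; spec_at x;
  unfold setU, setI, setD, set1, mkset in *; cbv beta in *;
  intuition (subst; auto).

Lemma setD1U (T : Type) (X : set T) x : X x -> (X `\ x) `|` [set x] = X.
Proof.
move=> Xx; apply/seteqP; split => y /=; first by case=> [[]|->].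
by have [->|] := pselect (y = x); [right|left].
Qed.

Lemma nsub_ex (T : Type) (A B : set T) : ~ A `<=` B -> exists2 x, A x & ~ B x.
Proof.
move=> AB; apply: contrapT => H; apply: AB => x Ax.
by apply: contrapT => Bx; apply: H; exists x.
Qed.

Lemma card_eqI0 (T : Type) (X : set T) : X #= `I_0 -> X = set0.
Proof. by rewrite II0 card_eq0 => /eqP. Qed.

Lemma finite_set_indU (T : Type) (P : set T -> Prop) :
  P set0 -> (forall A a, finite_set A -> P A -> P (A `|` [set a])) ->
  forall A, finite_set A -> P A.
Proof.
move=> P0 PS A /finite_setP[n]; elim: n A => [|n IH] A.
  by move=> /card_eqI0 ->.
move=> /eq_cardSP[x Ax An]; rewrite -(setD1U Ax).
by apply: PS; [apply/finite_setP; exists n|apply: IH].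
Qed.

(** Every rank function constructed below obtains the axiom [rk_card] in this way, from unit
    increase. *)
Lemma unit_rk_card (T : Type) (E : set T) (r : set T -> nat) :
  r set0 = 0 ->
  (forall A e, A `<=` E -> E e -> r (A `|` [set e]) <= (r A).+1) ->
  forall (X : set T) (n : nat), X `<=` E -> X #<= `I_n -> r X <= n.
Proof.
move=> r0 rS X n XE Xn.
have /finite_setP[k Xk] : finite_set X by apply/finite_set_leP; exists n.
have kn : k <= n by rewrite -card_le_II -(card_le_eql Xk).
apply: leq_trans kn; elim: k X XE Xk {Xn} => [|k IH] X XE.
  by move=> /card_eqI0 ->; rewrite r0.
move=> /eq_cardSP[x Xx Xk]; rewrite -(setD1U Xx).
have XxE : X `\ x `<=` E by move=> y [/XE].
apply: leq_trans (rS _ _ XxE (XE _ Xx)) _.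
by rewrite ltnS; apply: IH.
Qed.

Section Basics.
Variables (T : Type) (M : matroid T).
Implicit Types A B C D F G X Y : set T.
Local Notation E := (ground M).
Local Notation r := (rk M).

Lemma rk0 : r set0 = 0.
Proof.
have : r set0 <= 0 by apply: rk_card => //; rewrite II0 card_lexx.
by rewrite leqn0 => /eqP.
Qed.

Lemma rk1 e : E e -> r [set e] <= 1.
Proof.
move=> Ee; apply: rk_card; first by move=> x ->.
suff : [set e] #= `I_1 by rewrite card_eq_le => /andP[].
by apply/eq_cardSP; exists e => //; rewrite setDv II0.
Qed.

Lemma rk_le2 A B C D :
  A `<=` E -> B `<=` E -> C `<=` A `|` B -> D `<=` A `&` B ->
  r C + r D <= r A + r B.
Proof.
move=> AE BE CAB DAB; apply: leq_trans (rk_submod AE BE).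
by apply: leq_add; apply: rk_mono => //; sset.
Qed.

Lemma sub_ext A e : A `<=` E -> E e -> A `|` [set e] `<=` E.
Proof. by move=> AE Ee x [/AE|->]. Qed.

Lemma rkS A e : A `<=` E -> E e -> r (A `|` [set e]) <= (r A).+1.
Proof.
move=> AE Ee; have := rk1 Ee.
have eE : [set e] `<=` E by move=> x ->.
have := @rk_le2 A [set e] (A `|` [set e]) set0 AE eE (@subset_refl _ _) (@sub0set _ _).
rewrite rk0; lia.
Qed.

Lemma rk_dim A B C : A `<=` B -> B `<=` E -> C `<=` E ->
  r (B `|` C) + r A <= r (A `|` C) + r B.
Proof. by move=> AB BE CE; apply: rk_le2 => //; sset. Qed.

Definition cl A := [set e | E e /\ r (A `|` [set e]) = r A].

Lemma cl_ground A : cl A `<=` E.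
Proof. by move=> x []. Qed.

Lemma sub_cl A : A `<=` E -> A `<=` cl A.
Proof.
move=> AE x Ax; split; first exact: AE.
by congr r; apply/seteqP; split => y; [case=> [//|->]|left].
Qed.

Lemma rk_clU A B : A `<=` E -> B `<=` cl A -> r (A `|` B) = r A.
Proof.
move=> AE BA; have BE : B `<=` E by move=> x /BA [].
have ABE : A `|` B `<=` E by move=> x [/AE|/BE].
(* [B] may be infinite, since modular extensions need not be finite; a finite [Y] of the same rank
   as [A ∪ B] makes induction possible. *)
have [Y [Yf YAB rY]] := rk_finitary ABE.
suff AY : r (A `|` Y) = r A.
  apply/eqP; rewrite eqn_leq; apply/andP; split; last by apply: rk_mono => //; sset.
  rewrite -rY -AY; apply: rk_mono; first exact: subsetUr.
  by move=> x [/AE//|/YAB/ABE].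
clear rY; revert YAB; elim/finite_set_indU: Y / Yf => [|Y a Yf IH] YAB.
  by rewrite setU0.
have YAB' : Y `<=` A `|` B by move=> y Yy; apply: YAB; left.
have [Ea ra] : cl A a.
  have : (A `|` B) a by apply: YAB; right.
  by case=> [/(sub_cl AE)|/BA].
have aE : [set a] `<=` E by move=> x ->.
have YE : A `|` Y `<=` E by move=> x [/AE|/YAB'/ABE].
have := @rk_dim A (A `|` Y) [set a] (@subsetUl _ _ _) YE aE.
have := @rk_mono _ M (A `|` Y) (A `|` Y `|` [set a]) (@subsetUl _ _ _) (sub_ext YE Ea).
rewrite (IH YAB') ra setUA; lia.
Qed.

Lemma rk_cl A : A `<=` E -> r (cl A) = r A.
Proof.
by move=> AE; rewrite -(rk_clU AE (@subset_refl _ _)) (setUidr (sub_cl AE)).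
Qed.

Lemma cl_min A B : A `<=` B -> B `<=` E -> r B <= r A -> B `<=` cl A.
Proof.
move=> AB BE rBA b Bb; split; first exact: BE.
have AE : A `<=` E by move=> x /AB/BE.
apply/eqP; rewrite eqn_leq; apply/andP; split.
  by apply: leq_trans rBA; apply: rk_mono => // x [/AB|->].
by apply: rk_mono; [left|apply: sub_ext => //; apply: BE].
Qed.

Lemma cl_mono A B : A `<=` B -> B `<=` E -> cl A `<=` cl B.
Proof.
move=> AB BE x [Ex rx]; split => //.
have xE : [set x] `<=` E by move=> y ->.
have := rk_dim AB BE xE; rewrite rx.
have := @rk_mono _ M B (B `|` [set x]) (@subsetUl _ _ _) (sub_ext BE Ex); lia.
Qed.

Lemma flat_ground F : flat M F -> F `<=` E.
Proof. by case. Qed.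

Lemma flatE F : flat M F <-> F `<=` E /\ cl F `<=` F.
Proof.
split=> [[FE Fl]|[FE Fl]]; split=> //.
  by move=> x [Ex rx]; apply: contrapT => /(Fl _ Ex); rewrite rx ltnn.
move=> e Ee Fe; rewrite ltn_neqAle; apply/andP; split.
  by apply/eqP => rE; apply: Fe; apply: Fl.
by apply: rk_mono; [left|apply: sub_ext].
Qed.

Lemma flat_cl A : A `<=` E -> flat M (cl A).
Proof.
move=> AE; apply/flatE; split; first exact: cl_ground.
move=> x [Ex rx]; split => //.
have := rk_cl AE; rewrite -{}rx => rx.
have := @rk_mono _ M (A `|` [set x]) (cl A `|` [set x]).
rewrite rx => H.
apply/eqP; rewrite eqn_leq H /=.
- by apply: rk_mono; [left|apply: sub_ext].
- by move=> y [/(sub_cl AE)|]; [left|right].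
- by apply: sub_ext => //; apply: cl_ground.
Qed.

Lemma cl_sub_flat A F : flat M F -> A `<=` F -> cl A `<=` F.
Proof.
by move=> /flatE[FE clF] AF x /(cl_mono AF FE)/clF.
Qed.

Lemma flatI F G : flat M F -> flat M G -> flat M (F `&` G).
Proof.
move=> Ff Gf; have FE := flat_ground Ff.
apply/flatE; split=> [x [/FE]//|x cx]; split.
  by apply: cl_sub_flat cx => // y [].
by apply: cl_sub_flat cx => // y [].
Qed.

Lemma flat_groundM : flat M E.
Proof. by split. Qed.

Lemma flat_rkS F e : flat M F -> E e -> ~ F e -> r (F `|` [set e]) = (r F).+1.
Proof.
move=> [FE Fl] Ee Fe; apply/eqP; rewrite eqn_leq rkS //.
exact: Fl.
Qed.

Lemma notin_cl_rkS A e : A `<=` E -> E e -> ~ cl A e -> r (A `|` [set e]) = (r A).+1.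
Proof.
move=> AE Ee cA; apply/eqP; rewrite eqn_leq rkS //= ltn_neqAle rk_mono ?andbT.
- by apply/eqP => rA; apply: cA; split.
- by left.
- exact: sub_ext.
Qed.

Lemma flat_max F A : flat M F -> F `<=` A -> A `<=` E -> r A <= r F -> A `<=` F.
Proof. by move=> Ff FA AE rA; apply: subset_trans (cl_sub_flat Ff (@subset_refl _ F)); apply: cl_min. Qed.

Lemma flat_rk_lt F A : flat M F -> F `<=` A -> A `<=` E -> ~ (A `<=` F) -> r F < r A.
Proof.
by move=> Ff FA AE AF; rewrite ltnNge; apply/negP => /(flat_max Ff FA AE).
Qed.

Lemma ex_notin_cl A B : A `<=` E -> B `<=` E -> r A < r B -> exists2 b, B b & ~ cl A b.
Proof.
move=> AE BE rAB; apply: contrapT => H.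
have BA : B `<=` cl A by move=> b Bb; apply: contrapT => nb; apply: H; exists b.
have := rk_mono BA (@cl_ground _); rewrite rk_cl //; lia.
Qed.

Lemma hyper_flat H : hyperplane M H -> flat M H. Proof. by case. Qed.
Lemma hyper_ground H : hyperplane M H -> H `<=` E. Proof. by case=> [[]]. Qed.
Lemma hyper_rk H : hyperplane M H -> (r H).+1 = r E. Proof. by case. Qed.

Lemma rk_leE A : A `<=` E -> r A <= r E.
Proof. by move=> AE; apply: rk_mono. Qed.

(** Enlarge [A] by an element [x] outside the closure of [A ∪ {e}]: by exchange [e] stays outside
    the closure of [A ∪ {x}]. This stops when [A ∪ {e}] spans, and then the closure of [A] is a
    hyperplane. *)
Lemma hyper_avoid A e : A `<=` E -> E e -> ~ cl A e ->
  exists H, [/\ hyperplane M H, A `<=` H & ~ H e].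
Proof.
move: {2}(r E - r A) (leqnn (r E - r A)) => n; elim: n A => [|n IH] A rn AE Ee Ae.
  have [] := Ae; apply: (cl_min AE (@subset_refl _ _)) => //; lia.
have rA := notin_cl_rkS AE Ee Ae.
have AeE := sub_ext AE Ee.
have := rk_leE AeE; rewrite leq_eqVlt => /orP[/eqP rAE|].
  exists (cl A); split=> //; last exact: sub_cl.
  by split; [apply: flat_cl|rewrite rk_cl //; lia].
move=> /(ex_notin_cl AeE (@subset_refl _ _))[x Ex nx].
have rx := notin_cl_rkS AeE Ex nx.
have rAx : r A < r (A `|` [set x]).
  rewrite ltnNge; apply/negP => rle.
  apply: nx; apply: (cl_mono (@subsetUl _ A [set e])) => //.
  by apply: (cl_min (@subsetUl _ _ _) (sub_ext AE Ex) rle); right.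
have [||//||H [hH AH He]] := IH (A `|` [set x]); first lia.
- exact: sub_ext.
- move=> [_ rxe]; move: rx; rewrite setUAC rxe; have := rkS AE Ex; lia.
- by exists H; split=> // y Ay; apply: AH; left.
Qed.

Lemma hyper_ex A : A `<=` E -> r A < r E -> exists2 H, hyperplane M H & A `<=` H.
Proof.
move=> AE /(ex_notin_cl AE (@subset_refl _ _))[x Ex nx].
by have [H [hH AH _]] := hyper_avoid AE Ex nx; exists H.
Qed.

Lemma hyper_not_ground H : hyperplane M H -> exists2 e, E e & ~ H e.
Proof.
move=> hH; have HE := hyper_ground hH.
have [|e Ee ne] := ex_notin_cl HE (@subset_refl _ E); first by have := hyper_rk hH; lia.
by exists e => // He; apply: ne; apply: sub_cl.
Qed.

Lemma hyper_max H F : hyperplane M H -> H `<=` F -> F `<=` E -> r F < r E -> F `<=` H.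
Proof.
move=> hH HF FE rF; apply: flat_max => //; first exact: hyper_flat.
by have := hyper_rk hH; lia.
Qed.

Lemma hyper_eq H H' : hyperplane M H -> hyperplane M H' -> H `<=` H' -> H = H'.
Proof.
move=> hH hH' HH'; apply/seteqP; split=> //; apply: (hyper_max hH) => //.
  exact: hyper_ground.
by have := hyper_rk hH'; lia.
Qed.

Lemma hyperU H A : hyperplane M H -> H `<=` A -> A `<=` E -> ~ (A `<=` H) -> r A = r E.
Proof.
move=> hH HA AE AH; have := flat_rk_lt (hyper_flat hH) HA AE AH.
have := hyper_rk hH; have := rk_leE AE; lia.
Qed.

End Basics.

(** * Lifts along a quotient, push-forwards and contractions *)


(* [r'] is the rank function of a quotient of [M] of corank at most [m]. *)
Definition quotient_rank (T : Type) (M : matroid T) (r' : set T -> nat) (m : nat) :=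
  [/\ forall A B, A `<=` B -> B `<=` ground M -> r' A <= r' B,
      forall A B, A `<=` ground M -> B `<=` ground M ->
        r' (A `|` B) + r' (A `&` B) <= r' A + r' B,
      forall A B, A `<=` B -> B `<=` ground M -> rk M A + r' B <= rk M B + r' A &
      forall A, A `<=` ground M -> rk M A <= r' A + m].

(* The [m] new elements [z i] are as free as possible subject to the condition
   that contracting all of them induces the quotient [r'] on [M]. *)
Section HiggsLift.
Variables (T : Type) (M : matroid T) (r' : set T -> nat) (m : nat) (z : nat -> T).
Hypotheses (finM : finite_matroid M) (qr : quotient_rank M r' m).
Hypothesis zE : forall i, i < m -> ~ ground M (z i).
Hypothesis z_inj : forall i j, i < m -> j < m -> z i = z j -> i = j.
Local Notation E := (ground M).
Local Notation r := (rk M).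

Definition new_elts : set T := [set z i | i in `I_m].
Local Notation Z := new_elts.
Definition new_count (A : set T) : nat := \sum_(i < m) (`[< A (z i) >] : nat).
Local Notation c := new_count.
Definition higgs_rk A := minn (r (A `&` E) + c A) (r' (A `&` E) + m).

Lemma new_countUI A B : c (A `|` B) + c (A `&` B) = c A + c B.
Proof.
rewrite /c -!big_split /=; apply: eq_bigr => i _.
by rewrite asbool_or asbool_and; case: asboolP; case: asboolP.
Qed.

Lemma new_countS A B : A `<=` B -> c A <= c B.
Proof.
move=> AB; apply: leq_sum => i _; case: asboolP => // /AB Bz.
by rewrite asboolT.
Qed.

Lemma new_count0 A : A `<=` E -> c A = 0.
Proof.
move=> AE; apply: big1 => i _; apply/eqP; rewrite eqb0.
by apply/asboolP => /AE; apply: zE.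
Qed.

Lemma new_count_all A : Z `<=` A -> c A = m.
Proof.
move=> ZA; rewrite -[RHS]card_ord -sum1_card; apply: eq_bigr => i _.
by rewrite asboolT //; apply: ZA; exists i => //=; apply: ltn_ord.
Qed.

Lemma new_count1 i : i < m -> c [set z i] <= 1.
Proof.
move=> im; rewrite /c (bigD1 (Ordinal im)) //= big1 ?addn0; first by case: asbool.
move=> j ji; apply/eqP; rewrite eqb0; apply/asboolP => /z_inj zz.
by move/eqP: ji; apply; apply: val_inj; apply: zz.
Qed.

Lemma new_count_new i : i < m -> c [set z i] = 1.
Proof.
move=> im; apply/eqP; rewrite eqn_leq new_count1 //=.
by rewrite /c (bigD1 (Ordinal im)) //= asboolT.
Qed.

Lemma higgs_rk_sub A B : A `<=` B -> higgs_rk A <= higgs_rk B.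
Proof.
case: qr => q1 _ _ _ AB; rewrite /higgs_rk.
have ABE : A `&` E `<=` B `&` E by sset.
have := q1 _ _ ABE (@subIsetr _ _ _).
have := rk_mono ABE (@subIsetr _ _ _).
have := new_countS AB; lia.
Qed.

(** The minimum of two submodular functions is submodular if their difference is monotone. Here the
    difference is [r - r' + c - m], and [r - r'] is monotone by the third clause of
    [quotient_rank]. *)
Lemma higgs_rk_submod A B :
  higgs_rk (A `|` B) + higgs_rk (A `&` B) <= higgs_rk A + higgs_rk B.
Proof.
case: qr => q1 q2 q3 q4; rewrite /higgs_rk setIUl.
have -> : A `&` B `&` E = (A `&` E) `&` (B `&` E) by sset.
set A0 := A `&` E; set B0 := B `&` E.
have AE : A0 `<=` E := @subIsetr _ _ _.
have BE : B0 `<=` E := @subIsetr _ _ _.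
have ABE : A0 `|` B0 `<=` E by rewrite subUset.
have := rk_submod AE BE; have := q2 _ _ AE BE.
have := q3 _ _ (@subIsetl _ A0 B0) AE.
have := q3 _ _ (@subIsetr _ A0 B0) BE.
have := new_countUI A B.
have := new_countS (@subIsetl _ A B); have := new_countS (@subIsetr _ A B).
lia.
Qed.

Lemma higgs_rkS A e : A `<=` E `|` Z -> (E `|` Z) e ->
  higgs_rk (A `|` [set e]) <= (higgs_rk A).+1.
Proof.
case: qr => q1 q2 q3 q4 AEZ; case=> [Ee|[i im <-]]; rewrite /higgs_rk setIUl.
  have -> : [set e] `&` E = [set e] by sset.
  have := new_countUI A [set e].
  rewrite [c [set e]]new_count0 ?[c (_ `&` _)]new_count0; try by sset.
  have AE : A `&` E `<=` E by sset.
  have := q3 _ _ (@subsetUl _ (A `&` E) [set e]) (sub_ext AE Ee).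
  have := rkS AE Ee; lia.
have -> : [set z i] `&` E = set0.
  by apply/seteqP; split=> // x [-> /zE]; apply.
rewrite setU0; have := new_countUI A [set z i].
have := new_count1 im; lia.
Qed.

Lemma finite_new_elts : finite_set Z.
Proof. exact: finite_image (finite_II m). Qed.

Definition higgs : matroid T.
Proof.
refine (@Matroid T (E `|` Z) higgs_rk _ _ _ _).
- apply: unit_rk_card; last exact: higgs_rkS.
  by rewrite /higgs_rk set0I (rk0 M) new_count0 // min0n.
- by move=> X Y XY _; apply: higgs_rk_sub.
- by move=> X Y _ _; apply: higgs_rk_submod.
- move=> X XE; exists X; split=> //.
  by apply: sub_finite_set XE _; rewrite finite_setU; split=> //; apply: finite_new_elts.
Defined.

Lemma higgs_finite : finite_matroid higgs.
Proof. by rewrite /finite_matroid /= finite_setU; split=> //; apply: finite_new_elts. Qed.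

Lemma rk_higgs A n : A `<=` E ->
  rk higgs (A `|` (Z `&` n)) = minn (r A + c n) (r' A + m).
Proof.
move=> AE; rewrite /= /higgs_rk.
have -> : (A `|` (Z `&` n)) `&` E = A.
  apply/seteqP; split=> [x [[//|[[i im <-] _]] /zE]//|x Ax].
  by split; [left|apply: AE].
congr minn; congr (_ + _); apply: eq_bigr => i _; congr nat_of_bool.
apply/asbool_equiv_eq; split=> [[/AE/zE|[]]//|nz]; first by case/(_ (ltn_ord i)).
by right; split=> //; exists i => //=; apply: ltn_ord.
Qed.

Lemma rk_higgs_old A : A `<=` E -> rk higgs A = r A.
Proof.
case: qr => _ _ _ q4 AE; have := rk_higgs set0 AE.
by rewrite setI0 setU0 => ->; rewrite new_count0 // addn0; have := q4 _ AE; lia.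
Qed.

Lemma rk_higgs_all A : A `<=` E -> rk higgs (A `|` Z) = minn (r A) (r' A) + m.
Proof.
move=> AE; have := rk_higgs setT AE.
by rewrite setIT => ->; rewrite new_count_all // addn_minl.
Qed.

Lemma higgs_restricts : restricts_to higgs M.
Proof. by split; [left|apply: rk_higgs_old]. Qed.

End HiggsLift.

Section Push.
Variables (T U : Type) (f : T -> U) (M : matroid T).
Hypothesis f_inj : injective f.
Local Notation E := (ground M).

Lemma preimage_ground B : B `<=` f @` E -> f @^-1` B `<=` E.
Proof. by move=> BE x /BE[y Ey /f_inj <-]. Qed.

Lemma preimage_imageK A : f @^-1` (f @` A) = A.
Proof. by apply/seteqP; split=> [x [y Ay /f_inj <-]//|x Ax]; exists x. Qed.

Definition push : matroid U.
Proof.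
refine (@Matroid U (f @` E) (fun B => rk M (f @^-1` B)) _ _ _ _).
- apply: unit_rk_card => [|A e AE [x Ex <-]]; first exact: rk0.
  have -> : f @^-1` (A `|` [set f x]) = f @^-1` A `|` [set x].
    by apply/seteqP; split=> y [|]; [left|move/f_inj->; right|left|move=> ->; right].
  by apply: rkS => //; apply: preimage_ground.
- by move=> X Y XY YE; apply: rk_mono; [move=> x /XY|apply: preimage_ground].
- by move=> X Y XE YE; apply: (rk_submod (preimage_ground XE) (preimage_ground YE)).
- move=> X XE; have [Y [Yf YX rY]] := rk_finitary (preimage_ground XE).
  exists (f @` Y); split; first exact: finite_image.
    by move=> _ [y /YX Xy <-].
  by rewrite preimage_imageK.
Defined.

Lemma rk_push A : rk push (f @` A) = rk M A.
Proof. by rewrite /= preimage_imageK. Qed.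

Lemma push_iso : isomorphic M push.
Proof.
exists f; last by move=> X _; apply: rk_push.
split=> [x Ex|x y _ _ /f_inj //|x [y Ey <-]]; first by exists x.
by exists y.
Qed.

Lemma push_finite : finite_matroid M -> finite_matroid push.
Proof. exact: finite_image. Qed.

End Push.

Section Contract.
Variables (T : Type) (M : matroid T) (q : T).
Hypotheses (Eq : ground M q) (rq : rk M [set q] = 1).
Local Notation E := (ground M).
Local Notation r := (rk M).

Lemma rk_contract_gt0 A : A `<=` E -> 0 < r (A `|` [set q]).
Proof.
by move=> AE; rewrite -rq; apply: rk_mono; [right|apply: sub_ext].
Qed.

(** The element [q] stays in the ground set as a loop, so the flats of the contraction are literally
    the flats of [M] through [q]. The predecessor never truncates, as [q] is not a loop of [M]. *)
Definition contract : matroid T.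
Proof.
refine (@Matroid T E (fun A => (r (A `|` [set q])).-1) _ _ _ _).
- apply: unit_rk_card => [|A e AE Ee]; first by rewrite set0U rq.
  have := rkS (sub_ext AE Eq) Ee; rewrite setUAC.
  have := rk_contract_gt0 AE; lia.
- move=> X Y XY YE; have := @rk_mono _ M (X `|` [set q]) (Y `|` [set q]).
  have H : X `|` [set q] `<=` Y `|` [set q] by sset.
  move=> /(_ H (sub_ext YE Eq)); lia.
- move=> X Y XE YE.
  have XYE : X `|` Y `<=` E by sset.
  have IE : X `&` Y `<=` E by sset.
  have := rk_contract_gt0 XYE; have := rk_contract_gt0 IE.
  have := @rk_le2 _ M (X `|` [set q]) (Y `|` [set q]) (X `|` Y `|` [set q])
    (X `&` Y `|` [set q]) (sub_ext XE Eq) (sub_ext YE Eq).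
  have H1 : X `|` Y `|` [set q] `<=` X `|` [set q] `|` (Y `|` [set q]) by sset.
  have H2 : X `&` Y `|` [set q] `<=` (X `|` [set q]) `&` (Y `|` [set q]) by sset.
  move=> /(_ H1 H2); lia.
- move=> X XE; have [Y [Yf YX rY]] := rk_finitary (sub_ext XE Eq).
  exists (Y `&` X); split; [exact: finite_setIl|by move=> y []|].
  congr predn; apply/eqP; rewrite eqn_leq; apply/andP; split.
    by apply: rk_mono; [sset|apply: sub_ext].
  rewrite -rY; apply: rk_mono; first by move=> y Yy; case: (YX _ Yy) => ?; [left|right].
  by apply: sub_ext => // y [_ /XE].
Defined.

End Contract.

(** * The partition quotient *)


(* The flats X, Y and the covers of X ∩ Y contained in neither partition the
   ground set minus X ∩ Y; [part_rk] is the rank function of the rank-2 quotient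
   of [M] whose loops are X ∩ Y and whose parallel classes are the blocks. *)
Section PartitionQuotient.
Variables (T : Type) (M : matroid T) (X Y : set T).
Hypotheses (fX : flat M X) (fY : flat M Y).
Local Notation E := (ground M).
Local Notation r := (rk M).
Local Notation K := (X `&` Y).

Definition in_block B := [\/ B `<=` X, B `<=` Y | r (B `|` K) <= (r K).+1].

Definition part_rk (B : set T) : nat :=
  if `[< B `<=` K >] then 0 else if `[< in_block B >] then 1 else 2.

Lemma part_rk0 B : B `<=` K -> part_rk B = 0.
Proof. by move=> BK; rewrite /part_rk asboolT. Qed.

Lemma part_rk_gt0 B : ~ B `<=` K -> 0 < part_rk B.
Proof. by move=> BK; rewrite /part_rk asboolF //; case: asbool. Qed.

Lemma part_rk_le1 B : in_block B -> part_rk B <= 1.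
Proof. by move=> Bb; rewrite /part_rk; case: asbool => //; rewrite asboolT. Qed.

Lemma part_rk2 B : ~ in_block B -> part_rk B = 2.
Proof.
move=> Bb; rewrite /part_rk !asboolF // => BK; apply: Bb; apply: Or31.
by move=> x /BK[].
Qed.

Lemma part_rkP B : [\/ part_rk B = 0 /\ B `<=` K, 
  [/\ part_rk B = 1, ~ B `<=` K & in_block B] | part_rk B = 2 /\ ~ in_block B].
Proof.
have [BK|BK] := pselect (B `<=` K); first by apply: Or31; rewrite part_rk0.
have [Bb|Bb] := pselect (in_block B); last by apply: Or33; rewrite part_rk2.
apply: Or32; split=> //; have := part_rk_le1 Bb; have := part_rk_gt0 BK; lia.
Qed.

Let KE : K `<=` E. Proof. by move=> x [/(flat_ground fX)]. Qed.

Lemma in_blockS A B : A `<=` B -> B `<=` E -> in_block B -> in_block A.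
Proof.
move=> AB BE [BX|BY|rB].
- by apply: Or31 => x /AB/BX.
- by apply: Or32 => x /AB/BY.
- apply: Or33; apply: leq_trans rB; apply: rk_mono; first by sset.
  by rewrite subUset.
Qed.

Lemma in_block_cl A x : A `<=` E -> in_block A -> A x -> ~ K x ->
  [\/ X x /\ A `<=` X, Y x /\ A `<=` Y | A `<=` cl M (K `|` [set x])].
Proof.
move=> AE Ab Ax Kx; have xE := AE _ Ax.
case: Ab => [AX|AY|rA].
- by apply: Or31; split=> //; apply: AX.
- by apply: Or32; split=> //; apply: AY.
- apply: Or33; apply: subset_trans (@subsetUr _ K A) _.
  apply: cl_min; [by sset|by rewrite subUset|].
  by rewrite setUC (flat_rkS (flatI fX fY)).
Qed.

(** A single element [x] outside [K] determines its block: [X], [Y] or the closure of [K ∪ {x}].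
    This transitivity is the only non-trivial case of submodularity for [part_rk]. *)
Lemma in_blockU A B x : A `<=` E -> B `<=` E -> in_block A -> in_block B ->
  A x -> B x -> ~ K x -> in_block (A `|` B).
Proof.
move=> AE BE Ab Bb Ax Bx Kx; have xE := AE _ Ax.
have clX : X x -> cl M (K `|` [set x]) `<=` X.
  by move=> Xx; apply: cl_sub_flat => //; sset.
have clY : Y x -> cl M (K `|` [set x]) `<=` Y.
  by move=> Yx; apply: cl_sub_flat => //; sset.
case: (in_block_cl AE Ab Ax Kx) => [[Xx AX]|[Yx AY]|Ac];
case: (in_block_cl BE Bb Bx Kx) => [[Xx' BX]|[Yx' BY]|Bc].
- by apply: Or31; rewrite subUset.
- by case: Kx.
- by apply: Or31; rewrite subUset; split=> // y /Bc/(clX Xx).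
- by case: Kx.
- by apply: Or32; rewrite subUset.
- by apply: Or32; rewrite subUset; split=> // y /Bc/(clY Yx).
- by apply: Or31; rewrite subUset; split=> // y /Ac/(clX Xx').
- by apply: Or32; rewrite subUset; split=> // y /Ac/(clY Yx').
- apply: Or33; rewrite -(flat_rkS (flatI fX fY) xE Kx) -(rk_cl (sub_ext KE xE)).
  apply: rk_mono; last exact: cl_ground.
  rewrite !subUset; split; first by split.
  by apply: subset_trans (sub_cl (sub_ext KE xE)); left.
Qed.

Lemma part_rk_mono A B : A `<=` B -> B `<=` E -> part_rk A <= part_rk B.
Proof.
move=> AB BE.
case: (part_rkP B) => [[-> BK]|[-> BK Bb]|[-> _]].
- by rewrite part_rk0 // => x /AB/BK.
- exact: part_rk_le1 (in_blockS AB BE Bb).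
- by case: (part_rkP A) => [[-> ]|[->]|[->]].
Qed.

(** Sets of value 0 keep that value under closure, and so do sets inside one block. Hence every
    increase of [part_rk] forces an increase of [r]. *)
Lemma part_rk_null A B : A `<=` B -> B `<=` E -> r A + part_rk B <= r B + part_rk A.
Proof.
move=> AB BE; have AE := subset_trans AB BE.
have lt01 A' B' : A' `<=` B' -> B' `<=` E -> A' `<=` K -> ~ B' `<=` K -> r A' < r B'.
  move=> AB' BE' AK BK; rewrite ltnNge; apply/negP => rBA; apply: BK.
  apply: subset_trans (cl_sub_flat (flatI fX fY) AK); exact: cl_min.
have lt12 A' B' : A' `<=` B' -> B' `<=` E -> in_block A' -> ~ in_block B' -> r A' < r B'.
  move=> AB' BE' Ab Bb; rewrite ltnNge; apply/negP => rBA; apply: Bb.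
  have clA := cl_min AB' BE' rBA.
  case: Ab => [AX|AY|rA].
  - by apply: Or31; apply: subset_trans (cl_sub_flat fX AX).
  - by apply: Or32; apply: subset_trans (cl_sub_flat fY AY).
  - apply: Or33; apply: leq_trans rA.
    have AKE : A' `|` K `<=` E by rewrite subUset; split=> // x /AB'/BE'.
    rewrite -(rk_cl AKE); apply: rk_mono; last exact: cl_ground.
    rewrite subUset; split; last by apply: subset_trans (sub_cl AKE); right.
    by apply: subset_trans clA _; apply: cl_mono.
case: (part_rkP A) => [[-> AK]|[-> AK Ab]|[-> Ab]];
case: (part_rkP B) => [[-> BK]|[-> BK Bb]|[-> Bb]]; have := rk_mono AB BE; try lia.
- by have := lt01 _ _ AB BE AK BK; lia.
(* The value jumps from 0 to 2. The intermediate set [A ∪ {b}] lies in one block, so the rank grows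
   once below it and once above it. *)
- have [b Bb' Kb] : exists2 b, B b & ~ K b.
    by apply: nsub_ex => BK; apply: Bb; apply: Or31 => b /BK[].
  have AbB : A `|` [set b] `<=` B by rewrite subUset; split=> // x ->.
  have AbE := subset_trans AbB BE.
  have bb : in_block (A `|` [set b]).
    apply: Or33; rewrite -(flat_rkS (flatI fX fY) (BE _ Bb') Kb).
    by apply: rk_mono; [sset|apply: sub_ext => //; apply: BE].
  have := lt12 _ _ AbB BE bb Bb.
  have := lt01 _ _ (@subsetUl _ A [set b]) AbE AK.
  have nK : ~ A `|` [set b] `<=` K by move=> H; apply: Kb; apply: H; right.
  move=> /(_ nK); lia.
- by have := lt12 _ _ AB BE Ab Bb; lia.
Qed.

Lemma part_rk_submod A B : A `<=` E -> B `<=` E ->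
  part_rk (A `|` B) + part_rk (A `&` B) <= part_rk A + part_rk B.
Proof.
move=> AE BE; have ABE : A `|` B `<=` E by rewrite subUset.
have := part_rk_mono (@subIsetl _ A B) AE.
have := part_rk_mono (@subIsetr _ A B) BE.
have le2 C : part_rk C <= 2 by case: (part_rkP C) => [[->]|[->]|[->]].
have K0 C D : C `|` D `<=` E -> C `<=` K -> part_rk (C `|` D) <= part_rk D.
  move=> CDE CK; case: (part_rkP D) => [[-> DK]|[-> DK Db]|[-> _]]; last exact: le2.
    by rewrite part_rk0 // subUset.
  apply: part_rk_le1; case: Db => [DX|DY|rD].
  - by apply: Or31; rewrite subUset; split=> // x /CK[].
  - by apply: Or32; rewrite subUset; split=> // x /CK[].
  - apply: Or33; apply: leq_trans rD; apply: rk_mono; first by sset.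
    by rewrite subUset; split=> // x Dx; apply: CDE; right.
have := le2 (A `|` B).
case: (part_rkP A) => [[-> AK]|[-> AK Ab]|[-> _]].
- have := K0 A B ABE AK; lia.
- case: (part_rkP B) => [[-> BK]|[-> BK Bb]|[-> _]]; last lia.
    have := K0 B A; rewrite setUC => /(_ ABE BK).
    have := part_rk_le1 Ab; have := part_rk_gt0 AK.
    rewrite (@part_rk0 (A `&` B)); first lia.
    by move=> x [_ /BK].
  case: (part_rkP (A `&` B)) => [[-> _]|[-> IK _]|[-> _]]; try lia.
  have [x [Ax Bx] Kx] := nsub_ex IK.
  have := part_rk_le1 (in_blockU AE BE Ab Bb Ax Bx Kx); lia.
- lia.
Qed.

Lemma part_quotient m : part_rk E = 2 -> r E <= m + 2 -> quotient_rank M part_rk m.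
Proof.
move=> p2 rE; split.
- exact: part_rk_mono.
- exact: part_rk_submod.
- exact: part_rk_null.
- by move=> A AE; have := part_rk_null AE (@subset_refl _ E); rewrite p2; lia.
Qed.

End PartitionQuotient.

(** * Sticky matroids *)


Section Iso.
Variables (T U : Type) (M : matroid T) (M' : matroid U) (f : T -> U).
Hypothesis bf : set_bij (ground M) (ground M') f.
Hypothesis rf : forall X, X `<=` ground M -> rk M' (f @` X) = rk M X.
Local Notation E := (ground M).

Lemma iso_sub X : X `<=` E -> f @` X `<=` ground M'.
Proof. by case: bf => fE _ _ XE _ [x /XE Ex <-]; apply: fE. Qed.

Lemma iso_mem X x : X `<=` E -> E x -> (f @` X) (f x) -> X x.
Proof.
case: bf => _ fi _ XE Ex [y Xy]; have Ey := XE _ Xy.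
by move/(fi _ _ (mem_set Ey) (mem_set Ex)) => <-.
Qed.

Lemma iso_pre Y : Y `<=` ground M' -> exists2 X, X `<=` E & Y = f @` X.
Proof.
case: bf => _ _ fs YE; exists (E `&` f @^-1` Y) => [x []//|].
apply/seteqP; split=> [y Yy|_ [x [_ Yfx] <-]//].
by have [x Ex xy] := fs _ (YE _ Yy); exists x => //; split=> //; rewrite /preimage /= xy.
Qed.

Lemma iso_ground : f @` E = ground M'.
Proof.
apply/seteqP; split; first exact: iso_sub.
by case: bf => _ _ fs y /fs[x Ex <-]; exists x.
Qed.

Lemma iso_rk_ground : rk M' (ground M') = rk M E.
Proof. by rewrite -iso_ground rf. Qed.

Lemma iso_setI X Y : X `<=` E -> Y `<=` E -> f @` (X `&` Y) = f @` X `&` f @` Y.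
Proof.
move=> XE YE; apply/seteqP; split=> [_ [x [Xx Yx] <-]|y [[x Xx <-] Yy]].
  by split; exists x.
by exists x => //; split=> //; apply: iso_mem Yy => //; apply: XE.
Qed.

Lemma iso_subset X Y : X `<=` E -> Y `<=` E -> (f @` X `<=` f @` Y) <-> (X `<=` Y).
Proof.
move=> XE YE; split=> XY x.
  by move=> Xx; apply: iso_mem => //; [apply: XE|apply: XY; exists x].
by case=> y /XY Yy <-; exists y.
Qed.

Lemma iso_flat X : X `<=` E -> flat M X <-> flat M' (f @` X).
Proof.
move=> XE; split=> -[FE Fl]; split.
- exact: iso_sub.
- move=> e; rewrite -iso_ground => -[x Ex <-] Xx.
  rewrite -image_set1 -image_setU !rf //; last exact: sub_ext.
  by apply: Fl => // Xx'; apply: Xx; exists x.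
- by [].
- move=> e Ee Xe; have := Fl (f e).
  rewrite -image_set1 -image_setU !rf //; last exact: sub_ext.
  apply; first by case: bf => + _ _; apply.
  by move/(iso_mem XE Ee).
Qed.

Lemma iso_hyperplane X : X `<=` E -> hyperplane M X <-> hyperplane M' (f @` X).
Proof.
by move=> XE; split=> -[fX rX]; split; move: rX;
  rewrite ?iso_rk_ground ?rf //; move: fX; rewrite iso_flat.
Qed.

Lemma iso_modular_pair X Y : X `<=` E -> Y `<=` E ->
  modular_pair M X Y <-> modular_pair M' (f @` X) (f @` Y).
Proof.
move=> XE YE; have JE : X `|` Y `<=` E by rewrite subUset.
have KE : X `&` Y `<=` E by move=> x [/XE].
by rewrite /modular_pair -iso_setI // -image_setU !rf.
Qed.

Lemma iso_modular : modular M' -> modular M.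
Proof.
move=> mM X Y fX fY; have XE := flat_ground fX; have YE := flat_ground fY.
by apply/(iso_modular_pair XE YE); apply: mM; apply/iso_flat.
Qed.

Lemma iso_hypermodular : hypermodular M -> hypermodular M'.
Proof.
move=> hM X Y hX hY.
have [X0 X0E eX] := iso_pre (hyper_ground hX).
have [Y0 Y0E eY] := iso_pre (hyper_ground hY).
move: hX hY; rewrite eX eY => /(iso_hyperplane X0E) hX /(iso_hyperplane Y0E) hY.
by apply/iso_modular_pair => //; apply: hM.
Qed.

Lemma iso_OTE : OTE M -> OTE M'.
Proof.
move=> oM C' [C'f C'up C'I] [F' C'F'].
have C'E := fun F (CF : C' F) => flat_ground (C'f _ CF).
have [F0 F0E eF] := iso_pre (C'E _ C'F').
have [||F fF CF] := oM [set F | F `<=` E /\ C' (f @` F)].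
- split.
  + by move=> F [FE /C'f]; rewrite -iso_flat.
  + move=> F G [FE CF] fG FG; have GE := flat_ground fG; split=> //.
    by apply: C'up CF _ _; [apply/iso_flat|apply/iso_subset].
  + move=> F G [FE CF] [GE CG] mFG; split; first by move=> x [/FE].
    by rewrite iso_setI //; apply: C'I => //; apply/iso_modular_pair.
- by exists F0; split=> //; rewrite -eF.
have FE := flat_ground fF.
exists (f @` F).
  exact/(iso_flat FE).
have CP G : (G `<=` E /\ C' (f @` G)) = (flat M G /\ F `<=` G).
  by have := congr1 (fun D : set (set T) => D G) CF.
apply/seteqP; split=> [G' CG'|G'].
  have [G GE eG] := iso_pre (C'E _ CG').
  move: CG'; rewrite eG => CG'; have := conj GE CG'.
  by rewrite CP => -[fG FG]; split; [apply/iso_flat|apply/iso_subset].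
case=> fG'; have [G GE eG] := iso_pre (flat_ground fG').
move: fG'; rewrite eG => /(iso_flat GE) fG /(iso_subset FE GE) FG.
by have := conj fG FG; rewrite -CP => -[].
Qed.

Lemma iso_finite : finite_matroid M -> finite_matroid M'.
Proof. by rewrite /finite_matroid -iso_ground; apply: finite_image. Qed.

End Iso.

Lemma isomorphic_trans (T U V : Type) (M : matroid T) (N : matroid U) (P : matroid V) :
  isomorphic M N -> isomorphic N P -> isomorphic M P.
Proof.
move=> [f bf rf] [g bg rg]; exists (g \o f).
  exact: set_bij_comp bf bg.
by move=> X XE; rewrite -image_comp rg ?rf //; apply: (iso_sub bf).
Qed.

(* Here [Q] is contained in the closures of X and Y in the extension [N1] and
   makes (X, Y) modular. The competing extension first adds a pair W of elements in
   series in the place of a point p of Q outside the closure of X ∩ Y, so that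
   rk (A ∪ W) = rk (A ∪ p) + 1, and then the m points Z of the lift along
   the partition quotient. In any amalgam, submodularity for X and Y gives
   rk (Q ∪ Z) <= m and rk (Q ∪ W) <= rk Q + 1, hence rk (W ∪ Z) <= m + 1; but
   the two elements of W lie in different blocks, so that rk (W ∪ Z) = m + 2. *)
Section NoAmalgam.
Variables (U : Type) (M N1 : matroid U) (X Y Q : set U) (z : nat -> U).
Hypotheses (finM : finite_matroid M) (resM : restricts_to N1 M).
Hypotheses (fX : flat M X) (fY : flat M Y) (QE : Q `<=` ground N1).
Hypotheses (rXQ : rk N1 (X `|` Q) = rk M X) (rYQ : rk N1 (Y `|` Q) = rk M Y).
Hypothesis rQ : rk N1 Q + rk M (X `|` Y) = rk M X + rk M Y.
Hypothesis rKQ : rk M (X `&` Y) < rk N1 Q.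
Hypotheses (z_inj : injective z) (zE : forall i, ~ ground N1 (z i)).
Local Notation E := (ground M).
Local Notation K := (X `&` Y).
Local Notation J := (X `|` Y).

Let XE := flat_ground fX.
Let YE := flat_ground fY.
Let KE : K `<=` E. Proof. by move=> x [/XE]. Qed.
Let JE : J `<=` E. Proof. by rewrite subUset. Qed.
Let EE : E `<=` ground N1. Proof. by case: resM. Qed.
Let rN1 A : A `<=` E -> rk N1 A = rk M A. Proof. by case: resM => _; apply. Qed.

Lemma no_amalgam : exists N2 : matroid U,
  [/\ restricts_to N2 M, ground N1 `&` ground N2 = E & ~ exists N, amalgam N1 N2 N].
Proof.
have [p Qp Kp] : exists2 p, Q p & ~ cl N1 K p.
  by apply: ex_notin_cl => //; [exact: subset_trans EE|rewrite rN1].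
have Ep := QE Qp.
have pE A : A `<=` E -> A `|` [set p] `<=` ground N1.
  by move=> AE; apply: sub_ext => //; apply: subset_trans EE.
have rKp : rk N1 (K `|` [set p]) = (rk M K).+1.
  by rewrite notin_cl_rkS ?rN1 //; apply: subset_trans EE.
have p_le A : A `<=` E -> rk M A <= rk N1 (A `|` [set p]) <= (rk M A).+1.
  move=> AE; have AN := subset_trans AE EE; rewrite -(rN1 AE) rkS // andbT.
  by apply: rk_mono; [left|apply: pE].
have p_gt0 A : A `<=` E -> 0 < rk N1 (A `|` [set p]).
  move=> AE; have : 0 < rk N1 [set p].
    have := @rk_le2 _ N1 K [set p] (K `|` [set p]) set0.
    move=> /(_ (subset_trans KE EE)); rewrite rKp rk0 rN1 //.
    have pS : [set p] `<=` ground N1 by move=> x ->.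
    by move=> /(_ pS (@subset_refl _ _) (@sub0set _ _)); lia.
  by move=> p0; apply: leq_trans p0 _; apply: rk_mono; [right|apply: pE].
(* Contracting [p] lowers ranks by at most 1, but the lift adds two elements, so that [W] has one
   rank more than [p] over every subset of the ground set. *)
pose r1 A := (rk N1 (A `|` [set p])).-1.
have q1 : quotient_rank M r1 2.
  rewrite /r1; split.
  - move=> A B AB BE; have := @rk_mono _ N1 (A `|` [set p]) (B `|` [set p]).
    by move=> /(_ (setSU AB) (pE _ BE)); lia.
  - move=> A B AE BE.
    have ABE : A `|` B `<=` E by rewrite subUset.
    have IE : A `&` B `<=` E by move=> x [/AE].
    have := p_gt0 _ ABE; have := p_gt0 _ IE.
    have := @rk_le2 _ N1 _ _ (A `|` B `|` [set p]) (A `&` B `|` [set p]) (pE _ AE) (pE _ BE).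
    have H1 : A `|` B `|` [set p] `<=` A `|` [set p] `|` (B `|` [set p]) by sset.
    have H2 : A `&` B `|` [set p] `<=` (A `|` [set p]) `&` (B `|` [set p]) by sset.
    by move=> /(_ H1 H2); lia.
  - move=> A B AB BE; have AE := subset_trans AB BE.
    have pS : [set p] `<=` ground N1 by move=> x ->.
    have := rk_dim AB (subset_trans BE EE) pS.
    by rewrite (rN1 AE) (rN1 BE); have := p_gt0 _ BE; have := p_gt0 _ AE; lia.
  - by move=> A AE; have := p_le _ AE; lia.
have zE1 i : i < 2 -> ~ E (z i) by move=> _ /EE; apply: zE.
have zi1 i j : i < 2 -> j < 2 -> z i = z j -> i = j by move=> _ _ /z_inj.
pose Mw := higgs finM q1 zE1 zi1.
pose W := new_elts 2 z.
have WE : W `<=` ground Mw by right.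
have EMw : E `<=` ground Mw by left.
have rMw A : A `<=` E -> rk Mw A = rk M A by apply: rk_higgs_old.
have rW A : A `<=` E -> rk Mw (A `|` W) = (rk N1 (A `|` [set p])).+1.
  move=> AE; rewrite rk_higgs_all // /r1.
  by have := p_le _ AE; have := p_gt0 _ AE; lia.
(* This is why [p] is replaced by a pair: a single copy of [p] would be spanned by both X and Y,
   which would then no longer be flats, whereas the partition quotient on [Mw] needs flats. *)
have fMw F : flat M F -> flat Mw F.
  move=> fF; have FE := flat_ground fF.
  split=> [x /FE|e [Ee|[i i2 <-]] Fe]; first by left.
    rewrite !rMw //; last exact: sub_ext.
    by case: fF => _; apply.
  have -> : [set z i] = W `&` [set z i].
    by apply/seteqP; split=> [_ ->|x []//]; split=> //; exists i.
  rewrite rMw // rk_higgs // new_count_new // /r1.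
  by have := p_le _ FE; have := p_gt0 _ FE; lia.
have fXw := fMw _ fX; have fYw := fMw _ fY.
have XY : ~ X `<=` Y.
  move=> XY; have := rKQ; have := rQ.
  by rewrite (setIidl XY) (setUidr XY); lia.
have YX : ~ Y `<=` X.
  move=> YX; have := rKQ; have := rQ.
  by rewrite (setIidr YX) (setUidl YX); lia.
have W0 : W (z 0) by exists 0.
have rJ : (rk M K).+1 < rk M J.
  have : rk M K < rk M X.
    by apply: (flat_rk_lt (flatI fX fY) (@subIsetl _ _ _) XE) => H; apply: XY => x /H[].
  have : rk M X < rk M J.
    apply: (flat_rk_lt fX (@subsetUl _ _ _) JE) => H.
    by apply: YX => x Yx; apply: H; right.
  lia.
pose v := part_rk Mw X Y.
have rKMw : rk Mw K = rk M K by apply: rMw.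
have vW B : W `<=` B -> B `<=` ground Mw -> v B = 2.
  move=> WB BE; apply: part_rk2; rewrite /in_block rKMw => -[BX|BY|].
  - by apply: (zE (i := 0)); apply: EE; apply: XE; apply: BX; apply: WB.
  - by apply: (zE (i := 0)); apply: EE; apply: YE; apply: BY; apply: WB.
  - have : rk Mw (K `|` W) <= rk Mw (B `|` K).
      apply: rk_mono; first by move=> x [|/WB]; [right|left].
      by rewrite subUset; split=> // x /KE; left.
    by rewrite rW // rKp; lia.
(* Any [m] with rank at most [m + 2] would serve; the indices of Z are shifted by 2 because [z 0]
   and [z 1] form W. *)
pose m := rk Mw (ground Mw).
have q2 : quotient_rank Mw v m.
  apply: part_quotient => //; last by rewrite leq_addr.
  exact: vW.
have zE2 i : i < m -> ~ ground Mw (z (i + 2)).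
  move=> _ [/EE|[j j2 /z_inj ij]]; first exact: zE.
  by rewrite /= in j2; lia.
have zi2 i j : i < m -> j < m -> z (i + 2) = z (j + 2) -> i = j.
  by move=> _ _ /z_inj; lia.
have finMw : finite_matroid Mw by apply: higgs_finite.
pose N2 := higgs finMw q2 zE2 zi2.
pose Z := new_elts m (fun i => z (i + 2)).
have N2old A : A `<=` ground Mw -> rk N2 A = rk Mw A by apply: rk_higgs_old.
have N2Z A : A `<=` ground Mw -> rk N2 (A `|` Z) = v A + m.
  move=> AE; rewrite rk_higgs_all //; congr (_ + _).
  have := part_rk_null fXw fYw (@sub0set _ A) AE.
  by rewrite (part_rk0 _ (@sub0set _ _)) rk0 /v; lia.
have MwN2 : ground Mw `<=` ground N2 by left.
exists N2; split.
- split=> [x Ex|A AE]; first by apply/MwN2/EMw.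
  by rewrite N2old ?rMw //; apply: subset_trans EMw.
- apply/seteqP; split=> [x [N1x [[//|[i _ xi]]|[i _ xi]]]|x Ex].
  + by case: (zE (i := i)); rewrite xi.
  + by case: (zE (i := i + 2)); rewrite xi.
  + by split; [apply: EE|apply/MwN2/EMw].
move=> [N [gN [N1N rNN1] [N2N rNN2]]].
have XN : X `<=` ground N by apply: subset_trans N1N; apply: subset_trans EE.
have YN : Y `<=` ground N by apply: subset_trans N1N; apply: subset_trans EE.
have QN : Q `<=` ground N by apply: subset_trans N1N.
have ZN : Z `<=` ground N by apply: subset_trans N2N; right.
have WN : W `<=` ground N by apply: subset_trans N2N; apply: subset_trans MwN2.
have XQN : X `|` Q `<=` ground N by rewrite subUset.
have YQN : Y `|` Q `<=` ground N by rewrite subUset.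
have rNX : rk N X = rk M X by rewrite rNN1 ?rN1 //; apply: subset_trans EE.
have rNY : rk N Y = rk M Y by rewrite rNN1 ?rN1 //; apply: subset_trans EE.
have rNXQ : rk N (X `|` Q) = rk M X.
  by rewrite rNN1 // subUset; split=> //; apply: subset_trans EE.
have rNYQ : rk N (Y `|` Q) = rk M Y.
  by rewrite rNN1 // subUset; split=> //; apply: subset_trans EE.
have rNQ : rk N Q = rk N1 Q by apply: rNN1.
have rNZ A : A `<=` ground Mw -> rk N (A `|` Z) = v A + m.
  move=> AE; rewrite rNN2 ?N2Z // subUset; split; last by right.
  exact: subset_trans MwN2.
have rNW A : A `<=` E -> rk N (A `|` W) = (rk N1 (A `|` [set p])).+1.
  have AWw : forall A, A `<=` E -> A `|` W `<=` ground Mw.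
    by move=> A' AE; rewrite subUset; split=> // x /AE; left.
  move=> AE; rewrite rNN2 ?N2old ?rW //; try exact: AWw.
  by apply: subset_trans MwN2; apply: AWw.
have sub3 A B C : A `<=` ground N -> B `<=` ground N -> C `<=` ground N ->
  A `|` B `|` C `<=` ground N by move=> AN BN CN; rewrite !subUset.
have ZQ : rk N (Q `|` Z) <= m.
  have vX : v X <= 1 by apply: part_rk_le1; apply: Or31.
  have vY : v Y <= 1 by apply: part_rk_le1; apply: Or32.
  have vJ : v J = 2.
    apply: part_rk2; rewrite /in_block rKMw => -[H|H|].
    - by apply: YX => x Yx; apply: H; right.
    - by apply: XY => x Xx; apply: H; left.
    - have -> : J `|` K = J by sset.
      by rewrite rMw //; lia.
  have := rk_dim (@subsetUl _ X Q) XQN ZN.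
  have := rk_dim (@subsetUl _ Y Q) YQN ZN.
  have XMw := subset_trans XE EMw; have YMw := subset_trans YE EMw.
  have JMw := subset_trans JE EMw.
  rewrite rNXQ rNYQ rNX rNY (rNZ _ XMw) (rNZ _ YMw).
  have := @rk_le2 _ N (X `|` Q `|` Z) (Y `|` Q `|` Z) (J `|` Z) (Q `|` Z).
  move=> /(_ (sub3 _ _ _ XN QN ZN) (sub3 _ _ _ YN QN ZN)).
  have H1 : J `|` Z `<=` X `|` Q `|` Z `|` (Y `|` Q `|` Z) by clear; sset.
  have H2 : Q `|` Z `<=` (X `|` Q `|` Z) `&` (Y `|` Q `|` Z) by clear; sset.
  by move=> /(_ H1 H2); rewrite (rNZ _ JMw) vJ; lia.
have WQ : rk N (Q `|` W) <= (rk N1 Q).+1.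
  have pX : rk N1 (X `|` [set p]) <= rk M X.
    rewrite -rXQ; apply: rk_mono; first by move=> x [|->]; [left|right].
    by rewrite subUset; split=> //; apply: subset_trans EE.
  have pY : rk N1 (Y `|` [set p]) <= rk M Y.
    rewrite -rYQ; apply: rk_mono; first by move=> x [|->]; [left|right].
    by rewrite subUset; split=> //; apply: subset_trans EE.
  have pJ := p_le _ JE.
  have := rk_dim (@subsetUl _ X Q) XQN WN.
  have := rk_dim (@subsetUl _ Y Q) YQN WN.
  rewrite rNXQ rNYQ rNX rNY (rNW _ XE) (rNW _ YE).
  have := @rk_le2 _ N (X `|` Q `|` W) (Y `|` Q `|` W) (J `|` W) (Q `|` W).
  move=> /(_ (sub3 _ _ _ XN QN WN) (sub3 _ _ _ YN QN WN)).
  have H1 : J `|` W `<=` X `|` Q `|` W `|` (Y `|` Q `|` W) by clear; sset.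
  have H2 : Q `|` W `<=` (X `|` Q `|` W) `&` (Y `|` Q `|` W) by clear; sset.
  by move=> /(_ H1 H2); rewrite (rNW _ JE); have := rQ; lia.
have := @rk_le2 _ N (Q `|` Z) (Q `|` W) (W `|` Z) Q.
have QZN : Q `|` Z `<=` ground N by rewrite subUset.
have QWN : Q `|` W `<=` ground N by rewrite subUset.
have H1 : W `|` Z `<=` Q `|` Z `|` (Q `|` W) by clear; sset.
have H2 : Q `<=` (Q `|` Z) `&` (Q `|` W) by clear; sset.
by move=> /(_ QZN QWN H1 H2); rewrite (rNZ _ WE) vW // rNQ; lia.
Qed.

End NoAmalgam.

(** Passing to the type [T + nat] supplies the fresh elements of the competing extension; stickiness
    refers to all isomorphic copies, so this is harmless. *)
Lemma not_sticky (T0 T : Type) (M0 : matroid T0) (M N1 : matroid T) (X Y Q : set T) :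
  isomorphic M0 M -> finite_matroid M -> restricts_to N1 M ->
  flat M X -> flat M Y -> Q `<=` ground N1 ->
  rk N1 (X `|` Q) = rk M X -> rk N1 (Y `|` Q) = rk M Y ->
  rk N1 Q + rk M (X `|` Y) = rk M X + rk M Y ->
  rk M (X `&` Y) < rk N1 Q -> ~ sticky M0.
Proof.
move=> isoM finM resM fX fY QE rXQ rYQ rQ rKQ sM.
pose i : T -> T + nat := inl.
have i_inj : injective i by move=> x y [].
pose M' := push M i_inj; pose N1' := push N1 i_inj.
have res' : restricts_to N1' M'.
  split=> [_ [x Ex <-]|A AE]; first by exists x => //; case: resM => + _; apply.
  by case: resM => _; apply; apply: preimage_ground.
have [f bf rf] := push_iso M i_inj.
have flat' F : flat M F -> flat M' (i @` F).
  move=> fF; have FE := flat_ground fF.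
  apply/(@iso_flat _ _ M M' i) => // [|A AE]; last exact: rk_push.
  split=> [x Ex|x y _ _ /i_inj //|x [y Ey <-]]; first by exists x.
  by exists y.
have [|||||||||||N2 [resN2 gN2 noN]] :=
  @no_amalgam _ M' N1' (i @` X) (i @` Y) (i @` Q) (fun n => inr n).
- exact: push_finite.
- exact: res'.
- exact: flat'.
- exact: flat'.
- by move=> _ [x /QE Qx <-]; exists x.
- by rewrite -image_setU !rk_push.
- by rewrite -image_setU !rk_push.
- by rewrite -image_setU !rk_push.
- rewrite rk_push; suff -> : i @` X `&` i @` Y = i @` (X `&` Y) by rewrite rk_push.
  apply/seteqP; split=> [_ [[x Xx <-] [y Yy /i_inj yx]]|_ [x [Xx Yx] <-]].
    by exists x => //; split=> //; rewrite -yx.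
  by split; exists x.
- by move=> a b [].
- by move=> n [x _].
apply: noN; apply: (sM _ M') => //.
by apply: isomorphic_trans isoM _; apply: push_iso.
Qed.

Lemma sticky_hypermodular (T : Type) (M : matroid T) :
  finite_matroid M -> sticky M -> hypermodular M.
Proof.
move=> finM sM X Y hX hY; apply: contrapT => mXY.
pose i : T -> T + nat := inl.
have i_inj : injective i by move=> x y [].
have bf : set_bij (ground M) (ground (push M i_inj)) i.
  split=> [x Ex|x y _ _ /i_inj //|x [y Ey <-]]; first by exists x.
  by exists y.
have rf : forall A, A `<=` ground M -> rk (push M i_inj) (i @` A) = rk M A.
  by move=> A _; apply: rk_push.
move: (hX) (hY) => /(iso_hyperplane bf rf (hyper_ground hX)) hX'.
move=> /(iso_hyperplane bf rf (hyper_ground hY)) hY'.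
move: mXY; rewrite (iso_modular_pair bf rf (hyper_ground hX) (hyper_ground hY)).
have isoM := push_iso M i_inj.
have finM' := push_finite i_inj finM.
have inrE n : ~ ground (push M i_inj) (inr n) by case.
move: (push M i_inj) (i @` X) (i @` Y) hX' hY' isoM finM' inrE => {bf rf i i_inj}.
move=> M' {hX hY}X {}Y hX hY isoM finM' inrE mXY.
have XE := hyper_ground hX; have YE := hyper_ground hY.
have XY : ~ X `<=` Y.
  move=> XY; apply: mXY; rewrite (hyper_eq hX hY XY).
  by rewrite /modular_pair setUid setIid.
have YX : ~ Y `<=` X.
  move=> YX; apply: mXY; rewrite (hyper_eq hY hX YX).
  by rewrite /modular_pair setUid setIid.
have rJ : rk M' (X `|` Y) = rk M' (ground M').
  apply: (hyperU hX); [by left|by rewrite subUset|].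
  by move=> H; apply: YX => x Yx; apply: H; right.
have lt : rk M' X + rk M' Y > rk M' (X `|` Y) + rk M' (X `&` Y).
  by rewrite ltn_neqAle rk_submod // andbT; apply/eqP => H; apply: mXY.
have fX := hyper_flat hX; have fY := hyper_flat hY.
have rX := hyper_rk hX; have rY := hyper_rk hY.
(* This is the rank that X ∩ Y would have if the pair of hyperplanes were modular, and also the
   corank of the partition quotient. The [m] new elements are independent and lie in the closures of
   both X and Y. *)
pose m := (rk M' X).-1.
have p2 : part_rk M' X Y (ground M') = 2.
  apply: part_rk2 => -[EX|EY|].
  - by apply: YX => y /YE/EX.
  - by apply: XY => y /XE/EY.
  - have -> : ground M' `|` X `&` Y = ground M' by sset.
    lia.
have rm : rk M' (ground M') <= m + 2 by rewrite /m; lia.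
have qr := part_quotient fX fY p2 rm.
have zE i : i < m -> ~ ground M' (inr i) by move=> _; apply: inrE.
have zi i j : i < m -> j < m -> inr i = inr j :> T + nat -> i = j by move=> _ _ [].
pose N1 := higgs finM' qr zE zi.
have rN1 A : A `<=` ground M' -> rk N1 (A `|` new_elts m inr) = part_rk M' X Y A + m.
  move=> AE; rewrite rk_higgs_all //; congr (_ + _).
  by have := part_rk_null fX fY (@sub0set _ A) AE; rewrite (part_rk0 _ (@sub0set _ _)) rk0; lia.
have pX : part_rk M' X Y X = 1.
  apply/eqP; rewrite eqn_leq part_rk_le1 ?part_rk_gt0 //; last exact: Or31.
  by move=> H; apply: XY => x /H[].
have pY : part_rk M' X Y Y = 1.
  apply/eqP; rewrite eqn_leq part_rk_le1 ?part_rk_gt0 //; last exact: Or32.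
  by move=> H; apply: YX => x /H[].
have rQ : rk N1 (new_elts m inr) = m.
  by have := rN1 set0 (@sub0set _ _); rewrite set0U part_rk0.
apply: (@not_sticky _ _ M M' N1 X Y (new_elts m inr)) sM => //.
- exact: higgs_restricts.
- by right.
- by rewrite rN1 // pX /m; lia.
- by rewrite rN1 // pY /m; lia.
- by rewrite rQ /m rJ; lia.
- by rewrite rQ /m; lia.
Qed.

(** For a non-modular pair X, Y, the closures in [N] form a modular pair with the same ranks and the
    same rank of the union. Their intersection therefore has rank larger than X ∩ Y and serves as
    Q. *)
Lemma sticky_embed_modular (T U : Type) (M : matroid T) (N : matroid U) :
  finite_matroid M -> sticky M -> modular N -> embeds M N -> modular M.
Proof.
move=> finM sM mN [N' resN' [f bf rf]].
apply: (iso_modular bf rf) => X Y fX fY; apply: contrapT => mXY.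
have XE := flat_ground fX; have YE := flat_ground fY.
case: (resN') => EN rN.
have XN := subset_trans XE EN; have YN := subset_trans YE EN.
have JE : X `|` Y `<=` ground N' by rewrite subUset.
have KE : X `&` Y `<=` ground N' by move=> x [/XE].
have lt : rk N' (X `|` Y) + rk N' (X `&` Y) < rk N' X + rk N' Y.
  by rewrite ltn_neqAle rk_submod // andbT; apply/eqP => H; apply: mXY.
have JN := subset_trans JE EN.
have cX := sub_cl XN; have cY := sub_cl YN.
have := mN _ _ (flat_cl XN) (flat_cl YN).
have rcJ : rk N (cl N X `|` cl N Y) = rk N' (X `|` Y).
  rewrite -rN // -(rk_cl JN); apply/eqP; rewrite eqn_leq; apply/andP; split.
    apply: rk_mono; last exact: cl_ground.
    by rewrite subUset; split; apply: cl_mono.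
  rewrite rk_cl //; apply: rk_mono; first exact: setUSS.
  by rewrite subUset; split; apply: cl_ground.
rewrite /modular_pair rcJ !rk_cl // (rN _ XE) (rN _ YE) => rQ.
have QN : cl N X `&` cl N Y `<=` ground N by move=> x [cx _]; apply: cl_ground cx.
apply: (@not_sticky _ _ M N' N X Y (cl N X `&` cl N Y)) sM => //.
- by exists f.
- exact: (iso_finite bf).
- by rewrite rk_clU ?rN // => x [].
- by rewrite rk_clU ?rN // => x [].
- lia.
- lia.
Qed.

(** * OTE matroids *)


Lemma principalP (T : Type) (M : matroid T) (C : set (set T)) :
  principal M C -> exists F, [/\ flat M F, C F & forall G, C G -> F `<=` G].
Proof.
case=> F fF ->; exists F; split=> //; last by move=> G [].
by split=> //; apply: subset_refl.
Qed.

Lemma hyper_cover (T : Type) (M : matroid T) H F :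
  hyperplane M H -> flat M F -> H `<=` F -> F = H \/ F = ground M.
Proof.
move=> hH fF HF; have FE := flat_ground fF.
have [FH|FH] := pselect (F `<=` H); first by left; apply/seteqP.
right; apply/seteqP; split=> //; apply: (flat_max fF) => //.
by rewrite (hyperU hH HF FE FH).
Qed.

Lemma OTE_hypermodular (T : Type) (M : matroid T) : OTE M -> hypermodular M.
Proof.
move=> oM X Y hX hY; apply: contrapT => mXY.
have fX := hyper_flat hX; have fY := hyper_flat hY; have fE := flat_groundM M.
have groundX H : hyperplane M H -> ~ ground M `<=` H.
  by move=> hH EH; have [e Ee He] := hyper_not_ground hH; apply/He/EH.
have [||F fF CF] := oM [set F | [\/ F = X, F = Y | F = ground M]].
- split.
  + by move=> F [] ->.
  + move=> F G [] -> fG FG.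
    * by case: (hyper_cover hX fG FG) => ->; [apply: Or31|apply: Or33].
    * by case: (hyper_cover hY fG FG) => ->; [apply: Or32|apply: Or33].
    * by apply: Or33; apply/seteqP; split=> //; apply: flat_ground.
  + have mYX : ~ modular_pair M Y X.
      by rewrite /modular_pair addnC setUC setIC.
    move=> F G [] -> [] -> //; rewrite ?setIid ?(setIidl (flat_ground _)) ?(setIidr (flat_ground _)) //;
    by [move=> _; apply: Or31|move=> _; apply: Or32|move=> _; apply: Or33].
- by exists X; apply: Or31.
have CP G : [\/ G = X, G = Y | G = ground M] = (flat M G /\ F `<=` G).
  by have := congr1 (fun D : set (set T) => D G) CF.
have [_ FX] : flat M X /\ F `<=` X by rewrite -CP; apply: Or31.
have [_ FY] : flat M Y /\ F `<=` Y by rewrite -CP; apply: Or32.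
have := conj fF (@subset_refl _ F).
rewrite -CP => -[FE|FE|FE].
- apply: mXY; rewrite FE in FY; rewrite (hyper_eq hX hY FY).
  by rewrite /modular_pair setUid setIid.
- apply: mXY; rewrite FE in FX; rewrite (hyper_eq hY hX FX).
  by rewrite /modular_pair setUid setIid.
- by apply: (groundX _ hX); rewrite -FE.
Qed.

(** For a modular pair F, G both spanning [p], submodularity for F ∪ {p} and G ∪ {p} leaves no room
    for [p] to raise the rank of F ∩ G. *)
Lemma trace_modular_cut (T : Type) (M N : matroid T) (p : T) : restricts_to N M ->
  modular_cut M [set F | flat M F /\ cl N F p].
Proof.
move=> [EN rN]; split=> [F []//|F G [fF Fp] fG FG|F G [fF Fp] [fG Gp] mFG].
  by split=> //; apply: cl_mono Fp => //; apply: subset_trans EN; apply: flat_ground.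
have FE := flat_ground fF; have GE := flat_ground fG.
have FN := subset_trans FE EN; have GN := subset_trans GE EN.
have JE : F `|` G `<=` ground M by rewrite subUset.
have KE : F `&` G `<=` ground M by move=> x [/FE].
split; first exact: flatI.
have Np := cl_ground Fp; split=> //; apply/eqP; rewrite eqn_leq; apply/andP; split; last first.
  by apply: rk_mono; [left|apply: sub_ext => //; apply: subset_trans EN].
have := @rk_le2 _ N (F `|` [set p]) (G `|` [set p]) (F `|` G) (F `&` G `|` [set p]).
case: Fp => _ ->; case: Gp => _ ->.
have H1 : F `|` G `<=` F `|` [set p] `|` (G `|` [set p]) by clear; sset.
have H2 : F `&` G `|` [set p] `<=` (F `|` [set p]) `&` (G `|` [set p]) by clear; sset.
move=> /(_ (sub_ext FN Np) (sub_ext GN Np) H1 H2).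
by move: mFG; rewrite /modular_pair (rN _ FE) (rN _ GE) (rN _ JE) (rN _ KE); lia.
Qed.

Lemma OTE_embed_modular (T U : Type) (M : matroid T) (N : matroid U) :
  OTE M -> modular N -> embeds M N -> modular M.
Proof.
move=> oM mN [N' resN' [f bf rf]].
have oN' := iso_OTE bf rf oM.
apply: (iso_modular bf rf) => X Y fX fY; apply: contrapT => mXY.
have XE := flat_ground fX; have YE := flat_ground fY.
case: (resN') => EN rN.
have XN := subset_trans XE EN; have YN := subset_trans YE EN.
have JE : X `|` Y `<=` ground N' by rewrite subUset.
have KE : X `&` Y `<=` ground N' by move=> x [/XE].
have lt : rk N' (X `|` Y) + rk N' (X `&` Y) < rk N' X + rk N' Y.
  by rewrite ltn_neqAle rk_submod // andbT; apply/eqP => H; apply: mXY.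
have JN := subset_trans JE EN; have KN := subset_trans KE EN.
have := mN _ _ (flat_cl XN) (flat_cl YN).
have rcJ : rk N (cl N X `|` cl N Y) <= rk N' (X `|` Y).
  rewrite -rN // -(rk_cl JN); apply: rk_mono; last exact: cl_ground.
  by rewrite subUset; split; apply: cl_mono.
rewrite /modular_pair !rk_cl // (rN _ XE) (rN _ YE) => rQ.
have QN : cl N X `&` cl N Y `<=` ground N by move=> x [cx _]; apply: cl_ground cx.
have [p [Xp Yp] Kp] : exists2 p, (cl N X `&` cl N Y) p & ~ cl N (X `&` Y) p.
  by apply: ex_notin_cl => //; rewrite (rN _ KE); lia.
have [|F [fF [_ Fp] CF]] := principalP (oN' _ (trace_modular_cut p resN') _).
  by exists X.
apply: Kp; apply: cl_mono Fp => // x Fx.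
by split; [apply: (CF X)|apply: (CF Y)].
Qed.

(** * OTE matroids of rank 4 are sticky *)


(** Both flats lie strictly between their intersection and the span of their union. In rank 4, where
    two planes are modular, this leaves a line and a plane spanning everything, or two coplanar
    lines, in both cases meeting in rank 0. *)
Lemma hypermodular_defect4 (T : Type) (M : matroid T) X Y :
  hypermodular M -> rk M (ground M) <= 4 -> flat M X -> flat M Y ->
  rk M (X `|` Y) + rk M (X `&` Y) < rk M X + rk M Y ->
  rk M (X `&` Y) = 0 /\ rk M X + rk M Y = (rk M (X `|` Y)).+1.
Proof.
move=> hM r4 fX fY lt; have XE := flat_ground fX; have YE := flat_ground fY.
have JE : X `|` Y `<=` ground M by rewrite subUset.
have KE : X `&` Y `<=` ground M by move=> x [/XE].
have rJ := rk_leE JE.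
have XY : ~ X `<=` Y by move=> XY; rewrite (setUidr XY) (setIidl XY) addnC ltnn in lt.
have YX : ~ Y `<=` X by move=> YX; rewrite (setUidl YX) (setIidr YX) ltnn in lt.
have KX : rk M (X `&` Y) < rk M X.
  by apply: (flat_rk_lt (flatI fX fY) (@subIsetl _ _ _) XE) => H; apply: XY => x /H[].
have KY : rk M (X `&` Y) < rk M Y.
  by apply: (flat_rk_lt (flatI fX fY) (@subIsetr _ _ _) YE) => H; apply: YX => x /H[].
have XJ : rk M X < rk M (X `|` Y).
  by apply: (flat_rk_lt fX (@subsetUl _ _ _) JE) => H; apply: YX => x Yx; apply: H; right.
have YJ : rk M Y < rk M (X `|` Y).
  by apply: (flat_rk_lt fY (@subsetUr _ _ _) JE) => H; apply: XY => x Xx; apply: H; left.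
have hh : (rk M X).+1 = rk M (ground M) -> (rk M Y).+1 = rk M (ground M) ->
    rk M X + rk M Y = rk M (X `|` Y) + rk M (X `&` Y) by move=> rX rY; apply: hM.
lia.
Qed.

(* The condition says that the connectivity [rk F + rk Z - rk (F ∪ Z)] of F
   with Z equals that of the ground set, which is its maximal value. *)
Lemma connectivity_modular_cut (T : Type) (M N : matroid T) (Z : set T) :
  restricts_to N M -> Z `<=` ground N ->
  modular_cut M [set F | flat M F /\
    rk N (F `|` Z) + rk M (ground M) = rk N (ground M `|` Z) + rk M F].
Proof.
move=> [EN rN] ZN.
have dim F G : F `<=` G -> G `<=` ground M ->
    rk N (G `|` Z) + rk M F <= rk N (F `|` Z) + rk M G.
  move=> FG GE; have := rk_dim FG (subset_trans GE EN) ZN.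
  by rewrite (rN _ GE) (rN _ (subset_trans FG GE)).
split=> [F []//|F G [fF eF] fG FG|F G [fF eF] [fG eG] mFG]; split=> //.
- have GE := flat_ground fG; have := dim _ _ FG GE; have := dim _ _ GE (@subset_refl _ _).
  lia.
- exact: flatI.
have FE := flat_ground fF; have GE := flat_ground fG.
have JE : F `|` G `<=` ground M by rewrite subUset.
have KE : F `&` G `<=` ground M by move=> x [/FE].
have := dim _ _ KE (@subset_refl _ _); have := dim _ _ JE (@subset_refl _ _).
have FZ : F `|` Z `<=` ground N by rewrite subUset; split=> //; apply: subset_trans EN.
have GZ : G `|` Z `<=` ground N by rewrite subUset; split=> //; apply: subset_trans EN.
have := @rk_le2 _ N _ _ (F `|` G `|` Z) (F `&` G `|` Z) FZ GZ.
have H1 : F `|` G `|` Z `<=` F `|` Z `|` (G `|` Z) by clear; sset.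
have H2 : F `&` G `|` Z `<=` (F `|` Z) `&` (G `|` Z) by clear; sset.
move=> /(_ H1 H2); move: mFG; rewrite /modular_pair; lia.
Qed.

(** Let n(F) be the connectivity of F with Z. The hypotheses give n(X) + n(Y) = n(X ∪ Y) + 1 and n
    <= 1 on the ground set; by monotonicity n(X) = n(Y) = 1 is the maximal value. So X and Y lie in
    the connectivity cut, whose generator is contained in X ∩ Y, has rank 0 and hence connectivity
    0. *)
Lemma OTE_no_small_connectivity (T : Type) (M N : matroid T) (X Y Z : set T) :
  OTE M -> restricts_to N M -> Z `<=` ground N -> flat M X -> flat M Y ->
  rk M (X `&` Y) = 0 -> rk M X + rk M Y = (rk M (X `|` Y)).+1 ->
  rk N (X `|` Z) + rk N (Y `|` Z) = rk N (X `|` Y `|` Z) + rk N Z ->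
  rk M (ground M) + rk N Z <= (rk N (ground M `|` Z)).+1 -> False.
Proof.
move=> oM resN ZN fX fY rK rXY mXYZ smallE.
have XE := flat_ground fX; have YE := flat_ground fY.
have JE : X `|` Y `<=` ground M by rewrite subUset.
have KE : X `&` Y `<=` ground M by move=> x [/XE].
case: (resN) => EN rN.
have dim F G : F `<=` G -> G `<=` ground M ->
    rk N (G `|` Z) + rk M F <= rk N (F `|` Z) + rk M G.
  move=> FG GE; have := rk_dim FG (subset_trans GE EN) ZN.
  by rewrite (rN _ GE) (rN _ (subset_trans FG GE)).
have dXJ := dim _ _ (@subsetUl _ X Y) JE; have dYJ := dim _ _ (@subsetUr _ X Y) JE.
have dXE := dim _ _ XE (@subset_refl _ _); have dYE := dim _ _ YE (@subset_refl _ _).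
have [|F [fF [_ eF] CF]] := principalP (oM _ (connectivity_modular_cut resN ZN) _).
  by exists (ground M); split; [apply: flat_groundM|].
have FX : F `<=` X by apply: CF; split=> //; lia.
have FY : F `<=` Y by apply: CF; split=> //; lia.
have FK : F `<=` X `&` Y by move=> x Fx; split; [apply: FX|apply: FY].
have := rk_mono FK KE; rewrite rK leqn0 => /eqP rF.
have FZ : F `|` Z `<=` ground N.
  by rewrite subUset; split=> //; apply: subset_trans EN; apply: flat_ground.
have := rk_mono (@subsetUr _ F Z) FZ.
lia.
Qed.

Section ProperAmalgam.
Variables (U : Type) (M N1 N2 : matroid U).
Hypotheses (oM : OTE M) (r4 : rk M (ground M) = 4).
Hypotheses (res1 : restricts_to N1 M) (res2 : restricts_to N2 M).
Hypothesis gI : ground N1 `&` ground N2 = ground M.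
Local Notation E := (ground M).
Local Notation E1 := (ground N1).
Local Notation E2 := (ground N2).
Local Notation G := (ground N1 `|` ground N2).

(* Both ranks below are at least [rk M (B `&` E)], so the subtraction is exact. *)
Definition eta (B : set U) : nat := rk N1 (B `&` E1) + rk N2 (B `&` E2) - rk M (B `&` E).

Let EE1 : E `<=` E1. Proof. by case: res1. Qed.
Let EE2 : E `<=` E2. Proof. by case: res2. Qed.
Let r1E A : A `<=` E -> rk N1 A = rk M A. Proof. by case: res1 => _; apply. Qed.
Let r2E A : A `<=` E -> rk N2 A = rk M A. Proof. by case: res2 => _; apply. Qed.
Let IE A : A `&` E `<=` E. Proof. by move=> x []. Qed.
Let I1 A : A `&` E1 `<=` E1. Proof. by move=> x []. Qed.
Let I2 A : A `&` E2 `<=` E2. Proof. by move=> x []. Qed.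
Let le1 A : rk M (A `&` E) <= rk N1 (A `&` E1).
Proof. by rewrite -r1E //; apply: rk_mono => // x [Ax /EE1]. Qed.
Let le2 A : rk M (A `&` E) <= rk N2 (A `&` E2).
Proof. by rewrite -r2E //; apply: rk_mono => // x [Ax /EE2]. Qed.

Lemma etaE B : eta B + rk M (B `&` E) = rk N1 (B `&` E1) + rk N2 (B `&` E2).
Proof. by rewrite /eta subnK //; have := le1 B; lia. Qed.

Let candidates A n := `[< exists B, [/\ A `&` G `<=` B, B `<=` G & eta B = n] >].
Let candidates_ex A : exists n, candidates A n.
Proof. by exists (eta (A `&` G)); apply/asboolP; exists (A `&` G); split=> // x []. Qed.

(** [eta] can decrease when an element of [E] is added that is spanned on both sides. Minimizing
    over supersets repairs monotonicity, and submodularity becomes the only axiom at risk. *)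
Definition amalgam_rk A := ex_minn (candidates_ex A).
Local Notation f := amalgam_rk.

Lemma amalgam_rk_le A B : A `&` G `<=` B -> B `<=` G -> f A <= eta B.
Proof.
move=> AB BG; rewrite /f; case: ex_minnP => n _; apply.
by apply/asboolP; exists B.
Qed.

Lemma amalgam_rk_ex A : exists B, [/\ A `&` G `<=` B, B `<=` G & eta B = f A].
Proof. by rewrite /f; case: ex_minnP => n /asboolP[B []]; exists B. Qed.

(** Adding to [B] the closure in [M] of its trace on [E] changes neither the rank of the trace nor
    the ranks in [N1] and [N2]. The OTE hypothesis can only be applied to flat traces. *)
Lemma amalgam_rk_ex_flat A :
  exists B, [/\ A `&` G `<=` B, B `<=` G, eta B = f A & flat M (B `&` E)].
Proof.
have [B [AB BG eB]] := amalgam_rk_ex A.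
pose B' := B `|` cl M (B `&` E).
have cE : cl M (B `&` E) `<=` E := @cl_ground _ _ _.
have B'G : B' `<=` G by move=> x [/BG|/cE/EE1]; [|left].
have AB' : A `&` G `<=` B' by move=> x /AB; left.
have B'E : B' `&` E = cl M (B `&` E).
  apply/seteqP; split=> [x [[Bx|//] Ex]|x cx]; first exact: sub_cl.
  by split; [right|apply: cE].
exists B'; split=> //; last by rewrite B'E; apply: flat_cl.
apply/eqP; rewrite eqn_leq amalgam_rk_le // andbT.
have cl_sub (N : matroid U) : restricts_to N M ->
    rk N (B' `&` ground N) <= rk N (B `&` ground N).
  move=> [EN rN]; have BN : B `&` ground N `<=` ground N by move=> x [].
  have sub : cl M (B `&` E) `<=` cl N (B `&` ground N).
    apply: subset_trans (_ : cl N (B `&` E) `<=` _); last first.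
      by apply: cl_mono => // x [Bx /EN].
    move=> x [Ex rx]; split; first exact: EN.
    by rewrite !rN //; apply: sub_ext.
  rewrite -(rk_clU BN sub); apply: rk_mono.
    by move=> x [[Bx|]]; [left|right].
  by rewrite subUset; split=> // x /cE/EN.
have := cl_sub _ res1; have := cl_sub _ res2; have := etaE B; have := etaE B'.
rewrite B'E rk_cl // -eB; lia.
Qed.

Lemma amalgam_rk_mono A B : A `<=` B -> f A <= f B.
Proof.
move=> AB; have [C [BC CG <-]] := amalgam_rk_ex B.
by apply: amalgam_rk_le => // x [/AB Bx Gx]; apply: BC.
Qed.

Lemma amalgam_rk_submod A B : A `<=` G -> B `<=` G -> f (A `|` B) + f (A `&` B) <= f A + f B.
Proof.
move=> AG BG.
have [X [AX XG eX fX]] := amalgam_rk_ex_flat A.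
have [Y [BY YG eY fY]] := amalgam_rk_ex_flat B.
rewrite leqNgt; apply/negP; rewrite -{}eX -{}eY => lt.
(* Let n_i be the connectivity with Z = X ∩ Y in N_i. The minimality of eta
   bounds n_1 + n_2 on X ∩ E and Y ∩ E, which yields n_1 + n_2 <= 3 on E; the
   side with n_i <= 1 on E contradicts OTE. *)
pose Z := X `&` Y; pose J := X `|` Y.
have uJ S : J `<=` S -> S `<=` G -> f (A `|` B) <= eta S.
  move=> JS SG; apply: amalgam_rk_le => // x [[Ax|Bx] Gx]; apply: JS.
    by left; apply: AX.
  by right; apply: BY.
have uZ S : Z `<=` S -> S `<=` G -> f (A `&` B) <= eta S.
  move=> ZS SG; apply: amalgam_rk_le => // x [[Ax Bx] Gx]; apply: ZS.
  by split; [apply: AX|apply: BY].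
have JG : J `<=` G by rewrite subUset.
have ZG : Z `<=` G by move=> x [/XG].
have JIU S : J `&` S = X `&` S `|` Y `&` S by rewrite /J setIUl.
have ZII S : Z `&` S = (X `&` S) `&` (Y `&` S) by rewrite /Z; sset.
have := @rk_submod _ N1 _ _ (@I1 X) (@I1 Y); rewrite -JIU -ZII => s1.
have := @rk_submod _ N2 _ _ (@I2 X) (@I2 Y); rewrite -JIU -ZII => s2.
have := uJ _ (@subset_refl _ _) JG; have := uZ _ (@subset_refl _ _) ZG => uZZ uJJ.
have eX := etaE X; have eY := etaE Y; have eZ := etaE Z; have eJ := etaE J.
have hM := OTE_hypermodular oM.
have [] := @hypermodular_defect4 _ M _ _ hM _ fX fY; first by rewrite r4.
  by rewrite -JIU -ZII; lia.
rewrite -JIU -ZII => rZ0 rXY.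
(* The traces of X and Y have defect exactly 1 in [M], the least that [lt] can use. So submodularity
   for X and Y is tight in [N1] and in [N2], and [eta J], [eta Z] are the minimal values at [A ∪ B],
   [A ∩ B]. *)
have part (N : matroid U) : restricts_to N M -> ground N `<=` G ->
    rk N (J `&` ground N) + rk N (Z `&` ground N) = rk N (X `&` ground N) + rk N (Y `&` ground N) ->
    [/\ rk N (X `&` E `|` Z `&` ground N) + rk N (Y `&` E `|` Z `&` ground N) =
        rk N (J `&` E `|` Z `&` ground N) + rk N (Z `&` ground N),
        rk N (E `|` J `&` ground N) + rk N (J `&` E `|` Z `&` ground N) <=
        rk N (E `|` Z `&` ground N) + rk N (J `&` ground N) &
        rk M E + rk N (Z `&` ground N) <= (rk N (E `|` Z `&` ground N)).+1 -> False].
  move=> [EN rN] NG sN.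
  have IN S : S `&` ground N `<=` ground N by move=> x [].
  have EIN S : S `&` E `<=` ground N by move=> x [_ /EN].
  have UN S S' : S `&` E `|` S' `&` ground N `<=` ground N by rewrite subUset.
  have mXYZ : rk N (X `&` E `|` Z `&` ground N) + rk N (Y `&` E `|` Z `&` ground N) =
        rk N (J `&` E `|` Z `&` ground N) + rk N (Z `&` ground N).
    have XX : X `&` E `|` Z `&` ground N `<=` X `&` ground N.
      by move=> x [[Xx /EN]//|[[]]].
    have YY : Y `&` E `|` Z `&` ground N `<=` Y `&` ground N.
      by move=> x [[Xx /EN]//|[[]]].
    have := @rk_dim _ N _ _ (Y `&` ground N) XX (IN _) (IN _).
    have := @rk_dim _ N _ _ (X `&` E `|` Z `&` ground N) YY (IN _) (UN _ _).
    have <- : J `&` E `|` Z `&` ground N =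
      Y `&` E `|` Z `&` ground N `|` (X `&` E `|` Z `&` ground N).
      by rewrite JIU; clear; sset.
    rewrite -JIU [Y `&` ground N `|` _]setUC.
    have := @rk_le2 _ N (X `&` E `|` Z `&` ground N) (Y `&` E `|` Z `&` ground N)
      (J `&` E `|` Z `&` ground N) (Z `&` ground N) (UN _ _) (UN _ _).
    have H1 : J `&` E `|` Z `&` ground N `<=`
      X `&` E `|` Z `&` ground N `|` (Y `&` E `|` Z `&` ground N).
      by rewrite JIU; clear; sset.
    have H2 : Z `&` ground N `<=`
      (X `&` E `|` Z `&` ground N) `&` (Y `&` E `|` Z `&` ground N).
      by clear; sset.
    by move=> /(_ H1 H2); lia.
  split=> //.
    have JJ : J `&` E `|` Z `&` ground N `<=` J `&` ground N.
      by move=> x [[Jx /EN]//|[[Xx _] Nx]]; split=> //; left.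
    have := rk_dim JJ (IN _) EN.
    have -> : J `&` E `|` Z `&` ground N `|` E = E `|` Z `&` ground N by clear; sset.
    by rewrite [_ `|` E]setUC.
  apply: (@OTE_no_small_connectivity _ M N _ _ _ oM _ _ fX fY) => //.
  - by rewrite -ZII.
  - by rewrite -JIU.
  - by rewrite -JIU.
have [||m1 d1 c1] := part _ res1; [by left|by lia|].
have [||m2 d2 c2] := part _ res2; [by right|by lia|].
have uE := uJ (E `|` J) (@subsetUr _ _ _).
have EJG : E `|` J `<=` G by rewrite subUset; split=> // x /EE1; left.
have := uE EJG; have := etaE (E `|` J).
have EJI S : E `<=` S -> (E `|` J) `&` S = E `|` J `&` S.
  by move=> ES; rewrite setIUl (setIidl ES).
rewrite !EJI // (_ : E `|` J `&` E = E); last by clear; sset.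
have eta_ZX S : S `<=` G -> eta (S `&` E `|` Z) + rk M (S `&` E `|` Z `&` E) =
    rk N1 (S `&` E `|` Z `&` E1) + rk N2 (S `&` E `|` Z `&` E2).
  move=> SG.
  have SI C : E `<=` C -> (S `&` E `|` Z) `&` C = S `&` E `|` Z `&` C.
    move=> EC; rewrite setIUl; congr (_ `|` _).
    by apply/seteqP; split=> [x []//|x [Sx Ex]]; split=> //; apply: EC.
  by have := etaE (S `&` E `|` Z); rewrite !SI.
have SZG S : S `<=` G -> S `&` E `|` Z `<=` G.
  by move=> SG; rewrite subUset; split=> // x [/SG].
have := uZ _ (@subsetUr _ _ _) (SZG _ XG); have := eta_ZX _ XG.
have := uZ _ (@subsetUr _ _ _) (SZG _ YG); have := eta_ZX _ YG.
rewrite (_ : X `&` E `|` Z `&` E = X `&` E); last by rewrite /Z; clear; sset.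
rewrite (_ : Y `&` E `|` Z `&` E = Y `&` E); last by rewrite /Z; clear; sset.
move=> eYZ uYZ eXZ uXZ eEJ uEJ.
(* Tightness gives n_i(X) + n_i(Y) = n_i(J) + 1 on the traces. Minimality of [eta Z] bounds n_1 +
   n_2 by the rank on the traces of X and Y, hence by the rank minus 1 on that of J; minimality of
   [eta J] carries this bound over to [E], where it is 4 - 1 = 3. *)
have [small|small] : rk M E + rk N1 (Z `&` E1) <= (rk N1 (E `|` Z `&` E1)).+1 \/
   rk M E + rk N2 (Z `&` E2) <= (rk N2 (E `|` Z `&` E2)).+1 by lia.
- exact: c1.
- exact: c2.
Qed.

Lemma amalgam_rk1 A : A `<=` E1 -> f A = rk N1 A.
Proof.
move=> A1; have AG : A `<=` G by move=> x /A1; left.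
apply/eqP; rewrite eqn_leq; apply/andP; split.
  have := @amalgam_rk_le A A (@subIsetl _ _ _) AG; have := etaE A.
  have -> : A `&` E2 = A `&` E.
    by rewrite -gI setIA (setIidl A1).
  rewrite (setIidl A1) r2E //; lia.
have [B [AB BG <-]] := amalgam_rk_ex A.
have : rk N1 A <= rk N1 (B `&` E1).
  by apply: rk_mono => // x Ax; split; [apply: AB; split=> //; apply: AG|apply: A1].
have := etaE B; have := le2 B; lia.
Qed.

Lemma amalgam_rk2 A : A `<=` E2 -> f A = rk N2 A.
Proof.
move=> A2; have AG : A `<=` G by move=> x /A2; right.
apply/eqP; rewrite eqn_leq; apply/andP; split.
  have := @amalgam_rk_le A A (@subIsetl _ _ _) AG; have := etaE A.
  have -> : A `&` E1 = A `&` E.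
    by rewrite -gI [E1 `&` E2]setIC setIA (setIidl A2).
  rewrite (setIidl A2) r1E //; lia.
have [B [AB BG <-]] := amalgam_rk_ex A.
have : rk N2 A <= rk N2 (B `&` E2).
  by apply: rk_mono => // x Ax; split; [apply: AB; split=> //; apply: AG|apply: A2].
have := etaE B; have := le1 B; lia.
Qed.

Lemma amalgam_rkS A e : A `<=` G -> G e -> f (A `|` [set e]) <= (f A).+1.
Proof.
move=> AG Ge; have eG : [set e] `<=` G by move=> x ->.
have := amalgam_rk_submod AG eG.
suff : f [set e] <= 1 by lia.
case: Ge => [e1|e2].
  by rewrite amalgam_rk1; [apply: rk1|move=> x ->].
by rewrite amalgam_rk2; [apply: rk1|move=> x ->].
Qed.

(** Take finite sets spanning the two traces of [A]. If [B] contains both, then adding [A] to [B]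
    preserves its ranks in [N1] and [N2], and the rank of the trace on [E] can only grow, so [eta]
    does not increase. *)
Lemma amalgam_rk_finitary A : A `<=` G -> exists B, [/\ finite_set B, B `<=` A & f B = f A].
Proof.
move=> AG.
have [S1 [fin1 S1A rS1]] := rk_finitary (@I1 A).
have [S2 [fin2 S2A rS2]] := rk_finitary (@I2 A).
have SA : S1 `|` S2 `<=` A by move=> x [/S1A[]|/S2A[]].
exists (S1 `|` S2); split=> //; first by rewrite finite_setU.
apply/eqP; rewrite eqn_leq amalgam_rk_mono //=.
have [B [SB BG <-]] := amalgam_rk_ex (S1 `|` S2).
have ABG : B `|` A `<=` G by rewrite subUset.
apply: leq_trans (amalgam_rk_le (_ : A `&` G `<=` B `|` A) ABG) _.
  by move=> x [Ax _]; right.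
have span (N : matroid U) S : S `<=` A `&` ground N -> rk N S = rk N (A `&` ground N) ->
    S `<=` B -> rk N ((B `|` A) `&` ground N) = rk N (B `&` ground N).
  move=> SAN rS SBB; rewrite setIUl.
  have BN : B `&` ground N `<=` ground N by move=> x [].
  have AN : A `&` ground N `<=` ground N by move=> x [].
  apply: rk_clU => //; apply: (subset_trans (cl_min SAN AN _)); first by rewrite rS.
  by apply: cl_mono => // x Sx; split; [apply: SBB|case: (SAN _ Sx)].
have SB1 : S1 `<=` B by move=> x Sx; apply: SB; split; [left|apply/AG/SA; left].
have SB2 : S2 `<=` B by move=> x Sx; apply: SB; split; [right|apply/AG/SA; right].
have := span _ _ S1A rS1 SB1; have := span _ _ S2A rS2 SB2.
have : rk M (B `&` E) <= rk M ((B `|` A) `&` E).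
  by apply: rk_mono => // x [Bx Ex]; split=> //; left.
have := etaE B; have := etaE (B `|` A); lia.
Qed.

Definition proper_amalgam : matroid U.
Proof.
refine (@Matroid U G f _ _ amalgam_rk_submod amalgam_rk_finitary).
- apply: unit_rk_card; last exact: amalgam_rkS.
  by rewrite amalgam_rk1 ?rk0.
- by move=> X Y XY _; apply: amalgam_rk_mono.
Defined.

Lemma proper_amalgamP : amalgam N1 N2 proper_amalgam.
Proof.
split=> //; split.
- by left.
- exact: amalgam_rk1.
- by right.
- exact: amalgam_rk2.
Qed.

End ProperAmalgam.

Lemma OTE4_sticky (T : Type) (M : matroid T) :
  OTE M -> rk M (ground M) = 4 -> sticky M.
Proof.
move=> oM r4 U M' N1 N2 [f bf rf] res1 res2 gI.
have oM' := iso_OTE bf rf oM.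
have r4' : rk M' (ground M') = 4 by rewrite (iso_rk_ground bf rf).
by exists (proper_amalgam oM' r4' res1 res2 gI); apply: proper_amalgamP.
Qed.

(** * The Veblen-Young axiom for hyperplanes *)


(* Hyperplanes are the points and flats of corank 2 the lines of the dual
   geometry, in which [veblen] reads: if PQ and RS meet, so do PR and QS. *)
Definition veblen (T : Type) (M : matroid T) := forall P Q R S,
  hyperplane M P -> hyperplane M Q -> hyperplane M R -> hyperplane M S ->
  P <> R -> Q <> S ->
  (exists2 I, hyperplane M I & P `&` Q `<=` I /\ R `&` S `<=` I) ->
  exists2 I, hyperplane M I & P `&` R `<=` I /\ Q `&` S `<=` I.

(* Adding an element through a good cut creates no new hyperplanes. *)
Definition good_cut (T : Type) (M : matroid T) (C : set (set T)) :=
  forall G, flat M G -> (rk M G).+2 = rk M (ground M) ->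
  exists H, [/\ hyperplane M H, C H & G `<=` H].

(** This weakens OTE to the cuts that leave the hyperplanes unchanged, which is what a terminating
    completion can achieve. In rank 4 nothing is lost, by [rank4_good_cut]. *)
Definition saturated (T : Type) (M : matroid T) :=
  forall C, modular_cut M C -> C !=set0 -> good_cut M C -> principal M C.

Section Hypermodular.
Variables (T : Type) (M : matroid T).
Hypothesis hM : hypermodular M.
Local Notation E := (ground M).
Local Notation r := (rk M).

Lemma hyper_neq H H' : hyperplane M H -> hyperplane M H' -> H <> H' -> ~ H `<=` H'.
Proof. by move=> hH hH' HH' /(hyper_eq hH hH'). Qed.

Lemma hyper_rkU H H' : hyperplane M H -> hyperplane M H' -> H <> H' -> r (H `|` H') = r E.
Proof.
move=> hH hH' HH'; apply: (hyperU hH (@subsetUl _ _ _)).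
  by rewrite subUset; split; apply: hyper_ground.
by move=> HU; apply: (hyper_neq hH' hH) => [/esym//|x Hx]; apply: HU; right.
Qed.

Lemma hyperI_rk H H' : hyperplane M H -> hyperplane M H' -> H <> H' -> (r (H `&` H')).+2 = r E.
Proof.
move=> hH hH' HH'; have := hM hH hH'; rewrite /modular_pair hyper_rkU //.
by have := hyper_rk hH; have := hyper_rk hH'; lia.
Qed.

Lemma hyperI_flat H H' : hyperplane M H -> hyperplane M H' -> flat M (H `&` H').
Proof. by move=> hH hH'; apply: flatI; apply: hyper_flat. Qed.

Lemma line_eq P Q H : hyperplane M P -> hyperplane M Q -> hyperplane M H ->
  P <> Q -> P <> H -> P `&` Q `<=` H -> P `&` H = P `&` Q.
Proof.
move=> hP hQ hH PQ PH PQH; apply/seteqP; split; last by move=> x [Px Qx]; split=> //; apply: PQH.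
apply: (flat_max (hyperI_flat hP hQ)).
- by move=> x [Px Qx]; split=> //; apply: PQH.
- by move=> x [/(hyper_ground hP)].
- by have := hyperI_rk hP hQ PQ; have := hyperI_rk hP hH PH; lia.
Qed.

Lemma coline_cl_hyper G x : flat M G -> (r G).+2 = r E -> E x -> ~ G x ->
  hyperplane M (cl M (G `|` [set x])).
Proof.
move=> fG rG Ex Gx; have GE := sub_ext (flat_ground fG) Ex.
by split; [apply: flat_cl|rewrite rk_cl // flat_rkS].
Qed.

Lemma cover_sub A x : A `<=` E -> E x -> A `|` [set x] `<=` cl M (A `|` [set x]).
Proof. by move=> AE Ex; apply: sub_cl; apply: sub_ext. Qed.

Lemma principal_or_witness C : modular_cut M C -> C !=set0 ->
  principal M C \/ exists F F', [/\ C F, C F', ~ F `<=` F' & forall F'', C F'' -> r F <= r F''].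
Proof.
move=> [Cf Cup CI] [F0 CF0].
pose p n := `[< exists2 F, C F & r F = n >].
have pex : exists n, p n by exists (r F0); apply/asboolP; exists F0.
case: (ex_minnP pex) => n /asboolP[F CF rF] nmin.
have Fmin F' : C F' -> r F <= r F'.
  by move=> CF'; rewrite rF; apply: nmin; apply/asboolP; exists F'.
have [all|] := pselect (forall F', C F' -> F `<=` F'); last first.
  move=> /existsNP[F' /not_implyP[CF' FF']]; right; by exists F, F'.
left; exists F; first exact: Cf.
apply/seteqP; split=> [G CG|G [fG FG]]; last exact: Cup CF fG FG.
by split; [apply: Cf|apply: all].
Qed.

Lemma flat_rk0 F A : flat M F -> A `<=` E -> r A = 0 -> A `<=` F.
Proof.
move=> fF AE rA; apply: subset_trans (cl_sub_flat fF (@sub0set _ F)).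
by apply: cl_min => //; rewrite rA.
Qed.

Lemma ex_nonloop A : A `<=` E -> 0 < r A -> exists2 x, A x & r [set x] = 1.
Proof.
move=> AE rA; have [|x Ax nx] := ex_notin_cl (@sub0set _ E) AE; first by rewrite rk0.
exists x => //; have := notin_cl_rkS (@sub0set _ E) (AE _ Ax) nx.
by rewrite set0U rk0.
Qed.

Lemma rank4_good_cut C : r E = 4 -> modular_cut M C -> C !=set0 ->
  principal M C \/ good_cut M C.
Proof.
move=> r4 cC C0; have [|[F [F' [CF CF' FF' Fmin]]]] := principal_or_witness cC C0; first by left.
right; have [Cf Cup CI] := cC.
have fF := Cf _ CF; have fF' := Cf _ CF'.
have FE := flat_ground fF; have FE' := flat_ground fF'.
have hup A H : C A -> hyperplane M H -> A `<=` H -> C H.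
  by move=> CA hH AH; apply: Cup CA (hyper_flat hH) AH.
have I_C H1 H2 : C H1 -> C H2 -> hyperplane M H1 -> hyperplane M H2 -> C (H1 `&` H2).
  by move=> C1 C2 h1 h2; apply: CI => //; apply: hM.
have rF' : r F' < 4.
  rewrite ltnNge; apply/negP => rF'; apply: FF'.
  by apply: subset_trans FE _; apply: (flat_max fF') => //; rewrite r4.
have FI : r (F `&` F') < r F.
  apply: (flat_rk_lt (flatI fF fF') (@subIsetl _ _ _) FE) => FFF'.
  by apply: FF' => x /FFF'[].
have rFF' := Fmin _ CF'.
have [rF3|rF3] := eqVneq (r F) 3.
  have : C (F `&` F') by apply: I_C => //; split=> //; rewrite r4; lia.
  by move=> /Fmin; lia.
have [l Fl F'l] : exists2 l, F l & ~ F' l.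
  exact: nsub_ex.
have [H' [hH' F'H' H'l]] := hyper_avoid FE' (FE _ Fl) (fun c => F'l (cl_sub_flat fF' (@subset_refl _ _) c)).
have CH' : C H' := hup _ _ CF' hH' F'H'.
(* If a non-loop q of the line G lies on a member L of the cut of rank at most 2, then G ∪ L has
   rank at most 3, and a hyperplane containing it belongs to the cut. *)
suff through q : E q -> r [set q] = 1 -> exists2 L, C L & L q /\ r L <= 2.
  move=> G fG; rewrite r4 => -[rG]; have GE := flat_ground fG.
  have [q Gq rq] : exists2 q, G q & r [set q] = 1 by apply: ex_nonloop => //; rewrite rG.
  have [L CL [Lq rL]] := through q (GE _ Gq) rq.
  have LE := flat_ground (Cf _ CL).
  have qGL : [set q] `<=` G `&` L by move=> x ->.
  have := rk_le2 GE LE (@subset_refl _ _) qGL; rewrite rq rG => rGL.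
  have [||H hH GLH] := @hyper_ex _ M (G `|` L); first by rewrite subUset.
    by rewrite r4; lia.
  exists H; split=> //; last by move=> x Gx; apply: GLH; left.
  by apply: hup CL hH _ => x Lx; apply: GLH; right.
move=> Eq rq.
have [Fq|Fq] := pselect (F q).
  by exists F => //; split=> //; lia.
have [rF1|rF1] := leqP (r F) 1.
  exists (cl M (F `|` [set q])); last split.
  - apply: Cup CF (flat_cl (sub_ext FE Eq)) _.
    by apply: subset_trans (cover_sub FE Eq); left.
  - by apply: cover_sub => //; right.
  - by rewrite rk_cl ?flat_rkS //; apply: sub_ext.
have rF2 : r F = 2 by lia.
have cover x L : E x -> C L -> r L = 2 -> ~ L x ->
    let H := cl M (L `|` [set x]) in [/\ hyperplane M H, C H, L `<=` H & H x].
  move=> Ex CL rL Lx H; have fL := Cf _ CL; have LE := flat_ground fL.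
  have hH : hyperplane M H by apply: coline_cl_hyper => //; rewrite rL r4.
  have LH : L `|` [set x] `<=` H by apply: cover_sub.
  split=> //; [|by move=> y Ly; apply: LH; left|by apply: LH; right].
  by apply: hup CL hH _ => y Ly; apply: LH; left.
have meet H1 H2 : C H1 -> C H2 -> hyperplane M H1 -> hyperplane M H2 -> H1 <> H2 ->
    H1 q -> H2 q -> exists2 L, C L & L q /\ r L <= 2.
  move=> C1 C2 h1 h2 H12 q1 q2; exists (H1 `&` H2); first exact: I_C.
  by split=> //; have := hyperI_rk h1 h2 H12; rewrite r4; lia.
have [hP CP FP Pq] := cover _ _ Eq CF rF2 Fq.
set P := cl M (F `|` [set q]) in hP CP FP Pq.
have PH' : P <> H' by move=> PH; apply: H'l; rewrite -PH; apply: FP.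
have [H'q|H'q] := pselect (H' q); first exact: (meet P H').
(* P is so far the only plane of the cut known to pass through q. The plane spanned by F and x meets
   H' in a line of the cut through x; this line and q span a second plane of the cut, different from
   P because it contains x. *)
have [x H'x Px] : exists2 x, H' x & ~ P x.
  by apply: nsub_ex; apply: hyper_neq => // /esym.
have Ex := hyper_ground hH' H'x.
have Fx : ~ F x by move=> /FP.
have [hP2 CP2 FP2 P2x] := cover _ _ Ex CF rF2 Fx.
set P2 := cl M (F `|` [set x]) in hP2 CP2 FP2 P2x.
have PH2 : P2 <> H' by move=> PH; apply: H'l; rewrite -PH; apply: FP2.
have CL2 := I_C _ _ CP2 CH' hP2 hH'.
have rL2 : r (P2 `&` H') = 2 by have := hyperI_rk hP2 hH' PH2; rewrite r4; lia.
have L2q : ~ (P2 `&` H') q by case.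
have [hP3 CP3 LP3 P3q] := cover _ _ Eq CL2 rL2 L2q.
by apply: (meet P _ CP CP3) => // PP; apply: Px; rewrite PP; apply: LP3.
Qed.

(** Two flats of corank 2 span rank at most 2 (n - 2), where n is the rank of [M]; this is less than
    n exactly when n <= 3. *)
Lemma rank3_veblen : r E <= 3 -> veblen M.
Proof.
move=> r3 P Q R S hP hQ hR hS PR QS _.
have sub : P `&` R `|` Q `&` S `<=` E.
  by rewrite subUset; split=> x []; [move/(hyper_ground hP)|move/(hyper_ground hQ)].
have [||I hI] := @hyper_ex _ M (P `&` R `|` Q `&` S) => //.
  have := rk_le2 (flat_ground (hyperI_flat hP hR)) (flat_ground (hyperI_flat hQ hS))
    (@subset_refl _ _) (@sub0set _ _).
  by rewrite rk0; have := hyperI_rk hP hR PR; have := hyperI_rk hQ hS QS; lia.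
by rewrite subUset => -[]; exists I.
Qed.

End Hypermodular.

Lemma modular_hypermodular (T : Type) (M : matroid T) : modular M -> hypermodular M.
Proof. by move=> mM X Y hX hY; apply: mM; apply: hyper_flat. Qed.

(** With n the rank of [M], the common hyperplane of P ∩ Q and R ∩ S forces rank at least n - 3 on
    the intersection of all four. By the modular law P ∩ R and Q ∩ S then span rank at most n -
    1. *)
Lemma modular_veblen (T : Type) (M : matroid T) : modular M -> veblen M.
Proof.
move=> mM P Q R S hP hQ hR hS PR QS [I hI [PQI RSI]].
have hM := modular_hypermodular mM.
have [PQ|PQ] := pselect (P = Q); first by exists P => //; rewrite -PQ; split=> x [].
have [RS|RS] := pselect (R = S); first by exists R => //; rewrite -RS; split=> x [].
have [||I' hI'] := @hyper_ex _ M (P `&` R `|` Q `&` S).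
- by rewrite subUset; split=> x []; [move/(hyper_ground hP)|move/(hyper_ground hQ)].
- have := mM _ _ (hyperI_flat hP hQ) (hyperI_flat hR hS).
  have := mM _ _ (hyperI_flat hP hR) (hyperI_flat hQ hS).
  rewrite /modular_pair (setIACA P R) => e1 e2.
  have IE := hyper_ground hI.
  have PQRS : P `&` Q `|` R `&` S `<=` I by rewrite subUset.
  have := rk_mono PQRS IE; have := hyper_rk hI.
  have := hyperI_rk hM hP hR PR; have := hyperI_rk hM hQ hS QS.
  have := hyperI_rk hM hP hQ PQ; have := hyperI_rk hM hR hS RS; lia.
- by rewrite subUset => -[]; exists I'.
Qed.

Section KantorStep.
Variables (T : Type) (M : matroid T).
Local Notation E := (ground M).
Local Notation r := (rk M).

Section ContractHyperplanes.
Variable q : T.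
Hypotheses (Eq : E q) (rq : r [set q] = 1).
Local Notation Mq := (contract Eq rq).

Lemma rk_contract A : A `<=` E -> (rk Mq A).+1 = r (A `|` [set q]).
Proof. by move=> AE; rewrite /= prednK //; apply: rk_contract_gt0. Qed.

Lemma rk_contract_in A : A `<=` E -> A q -> (rk Mq A).+1 = r A.
Proof. by move=> AE Aq; rewrite rk_contract // setUidl // => x ->. Qed.

Lemma contract_flat F : flat Mq F <-> flat M F /\ F q.
Proof.
split=> [[FE Fl]|[[FE Fl] Fq]].
  have Fq : F q.
    apply: contrapT => Fq; have := Fl _ Eq Fq.
    rewrite -ltnS !rk_contract //; last exact: sub_ext.
    by rewrite -setUA setUid ltnn.
  split=> //; split=> // e Ee Fe; have := Fl _ Ee Fe.
  by rewrite -ltnS !rk_contract_in //; [apply: sub_ext|left].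
split=> // e Ee Fe; rewrite -ltnS !rk_contract_in //; first exact: Fl.
  exact: sub_ext.
by left.
Qed.

Lemma contract_hyperplane H : hyperplane Mq H <-> hyperplane M H /\ H q.
Proof.
rewrite /hyperplane contract_flat.
have E1 : (rk Mq E).+1 = r E by apply: rk_contract_in.
rewrite -[rk Mq (ground Mq)]/(rk Mq E).
split=> [[[fH Hq] rH]|[[fH rH] Hq]]; have := rk_contract_in (flat_ground fH) Hq.
  by split=> //; split=> //; lia.
by split=> //; lia.
Qed.

Lemma contract_hypermodular : hypermodular M -> hypermodular Mq.
Proof.
move=> hM X Y /contract_hyperplane[hX Xq] /contract_hyperplane[hY Yq].
have XE := hyper_ground hX; have YE := hyper_ground hY.
have := hM _ _ hX hY; rewrite /modular_pair.
have JE : X `|` Y `<=` E by rewrite subUset.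
have KE : X `&` Y `<=` E by move=> x [/XE].
have := rk_contract_in XE Xq; have := rk_contract_in YE Yq.
have := rk_contract_in JE (or_introl Xq); have := rk_contract_in KE (conj Xq Yq).
lia.
Qed.

Lemma contract_veblen P Q R S : veblen Mq ->
  hyperplane M P -> hyperplane M Q -> hyperplane M R -> hyperplane M S ->
  P q -> Q q -> R q -> S q -> P <> R -> Q <> S ->
  (exists2 I, hyperplane M I & P `&` Q `<=` I /\ R `&` S `<=` I) ->
  exists2 I, hyperplane M I & P `&` R `<=` I /\ Q `&` S `<=` I.
Proof.
move=> V hP hQ hR hS Pq Qq Rq Sq PR QS [I hI [PQI RSI]].
have [||||//|//||I' /contract_hyperplane[hI' _] sub] := V P Q R S;
  try by apply/contract_hyperplane.
- exists I => //; apply/contract_hyperplane; split=> //.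
  exact: PQI.
- by exists I'.
Qed.

End ContractHyperplanes.

(* The auxiliary hyperplane O meets all relevant lines, so that the
   configuration may be projected from O into the projective geometry of the
   hyperplanes through an element q of Q ∩ S outside O. *)
Lemma kantor_step : hypermodular M -> 5 <= r E ->
  (forall q (Eq : E q) (rq : r [set q] = 1), veblen (contract Eq rq)) -> veblen M.
Proof.
move=> hM r5 Vq P Q R S hP hQ hR hS PR QS [I hI [PQI RSI]].
have [PQ|PQ] := pselect (P = Q); first by exists P => //; rewrite -PQ; split=> x [].
have [RS|RS] := pselect (R = S); first by exists R => //; rewrite -RS; split=> x [].
have QP := not_eq_sym PQ; have SR := not_eq_sym RS.
have RP := not_eq_sym PR; have SQ := not_eq_sym QS.
have leq H1 H2 H3 := @line_eq _ _ hM H1 H2 H3.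
have [IP|IP] := pselect (P = I).
  exists S => //; split; last by move=> x [].
  rewrite setIC (leq R S P) //.
  by rewrite IP.
have [IQ|IQ] := pselect (Q = I).
  exists R => //; split; first by move=> x [].
  rewrite setIC (leq S R Q) //.
  by rewrite setIC IQ.
have [IR|IR] := pselect (R = I).
  exists Q => //; split; last by move=> x [].
  rewrite (leq P Q R) //.
  by rewrite IR.
have [IS|IS] := pselect (S = I).
  exists P => //; split; first by move=> x [].
  rewrite (leq Q P S) //.
  by rewrite setIC IS.
have PIQ x : P x -> I x -> Q x.
  by move=> Px Ix; have : (P `&` I) x by []; rewrite (leq P Q I) // => -[].
have QIP x : Q x -> I x -> P x.
  by move=> Qx Ix; have : (Q `&` I) x by []; rewrite (leq Q P I) // => [[]//|]; rewrite setIC.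
have RIS x : R x -> I x -> S x.
  by move=> Rx Ix; have : (R `&` I) x by []; rewrite (leq R S I) // => -[].
have SIR x : S x -> I x -> R x.
  by move=> Sx Ix; have : (S `&` I) x by []; rewrite (leq S R I) // => [[]//|]; rewrite setIC.
(* A non-loop common to I, Q and S lies in P and R as well, and the contraction at it settles the
   claim. From here on, I ∩ Q ∩ S contains only loops. *)
have [[q [Iq Qq Sq rq]]|no] := pselect (exists q, [/\ I q, Q q, S q & r [set q] = 1]).
  have Eq := hyper_ground hI Iq.
  apply: (contract_veblen (Vq q Eq rq)) => //; [exact: QIP|exact: SIR|].
  by exists I.
have noq x : I x -> Q x -> S x -> r [set x] = 1 -> False.
  by move=> Ix Qx Sx rx; apply: no; exists x.
have nonloop H1 H2 : hyperplane M H1 -> hyperplane M H2 -> H1 <> H2 ->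
    exists2 x, (H1 `&` H2) x & r [set x] = 1.
  move=> h1 h2 H12; apply: ex_nonloop; first exact: flat_ground (hyperI_flat h1 h2).
  by have := hyperI_rk hM h1 h2 H12; lia.
have [a [Ia Qa] ra] := nonloop I Q hI hQ (not_eq_sym IQ).
have [b [Ib Sb] rb] := nonloop I S hI hS (not_eq_sym IS).
have [d [Pd Rd] rd] := nonloop P R hP hR PR.
have Pa := QIP _ Qa Ia; have Rb := SIR _ Sb Ib.
have Sa : ~ S a by move=> Sa; apply: (noq a).
have Ra : ~ R a by move=> Ra; apply: Sa; apply: RIS.
have Qb : ~ Q b by move=> Qb; apply: (noq b).
have Pb : ~ P b by move=> Pb; apply: Qb; apply: PIQ.
have Id : ~ I d by move=> Id; apply: (noq d) => //; [apply: PIQ|apply: RIS].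
have Qd : ~ Q d by move=> Qd; apply: Id; apply: PQI.
have Sd : ~ S d by move=> Sd; apply: Id; apply: RSI.
have fQS := hyperI_flat hQ hS; have rQS := hyperI_rk hM hQ hS QS.
have Ed := hyper_ground hP Pd; have Ea := hyper_ground hI Ia; have Eb := hyper_ground hI Ib.
have QSE := flat_ground fQS.
have hN : hyperplane M (cl M (Q `&` S `|` [set d])).
  by apply: coline_cl_hyper => // -[].
have Nsub : Q `&` S `|` [set d] `<=` cl M (Q `&` S `|` [set d]) by apply: cover_sub.
exists (cl M (Q `&` S `|` [set d])) => //; split; last by move=> x QSx; apply: Nsub; left.
move=> d' [Pd' Rd'].
have Ed' := hyper_ground hP Pd'.
(* Rank at least 5 is needed here: four elements span rank at most 4. Treating one further element
   [d'] of P ∩ R at a time keeps their number at four. *)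
have [O hO [Oa Ob Od Od']] : exists2 O, hyperplane M O & [/\ O a, O b, O d & O d'].
  have [||O hO sub] := @hyper_ex _ M ([set a] `|` [set b] `|` [set d] `|` [set d']).
  - by move=> x [[[->|->]|->]|->].
  - have aE : [set a] `<=` E by move=> x ->.
    have := rkS (sub_ext (sub_ext aE Eb) Ed) Ed'.
    by have := rkS (sub_ext aE Eb) Ed; have := rkS aE Eb; lia.
  - exists O => //; split; apply: sub; [left; left; left|left; left; right|left; right|right] => //.
have OP : O <> P by move=> OP; apply: Pb; rewrite -OP.
have OR : O <> R by move=> OR; apply: Ra; rewrite -OR.
have OI : O <> I by move=> OI; apply: Id; rewrite -OI.
have [q [Qq Sq] Oq] : exists2 q, (Q `&` S) q & ~ O q.
  apply: nsub_ex => QSO.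
  have QSa : ~ (Q `&` S) a by case.
  have QO : Q `<=` O.
    apply: subset_trans (_ : cl M (Q `&` S `|` [set a]) `<=` O).
      apply: cl_min; first by move=> x [[]|->].
        exact: hyper_ground.
      by rewrite flat_rkS //; have := hyper_rk hQ; lia.
    apply: cl_sub_flat; first exact: hyper_flat.
    by move=> x [/QSO|->].
  by apply: Qb; rewrite (hyper_eq hQ hO QO).
have Eq := hyper_ground hQ Qq.
have rq : r [set q] = 1.
  have := rk1 Eq; case rq0 : (r [set q]) => [|[|//]] // _.
  by case: Oq; apply: (flat_rk0 (hyper_flat hO) _ rq0) => // x ->.
have fOI := hyperI_flat hO hI; have rOI := hyperI_rk hM hO hI OI.
have OIE := flat_ground fOI.
(* [H1] is the point through [q] on the dual line OI. The lines H1 O and QP meet in I, and all these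
   hyperplanes contain [a]; contraction at [a] yields A' on H1 Q and OP. In the same way contraction
   at [b] yields B' on H1 S and OR. *)
have [H1 [hH1 OIH1 H1q]] : exists H1, [/\ hyperplane M H1, O `&` I `<=` H1 & H1 q].
  exists (cl M (O `&` I `|` [set q])).
  have := cover_sub OIE Eq => sub; split; last by apply: sub; right.
    by apply: coline_cl_hyper => // -[].
  by move=> x OIx; apply: sub; left.
have OH1 : O <> H1 by move=> OH; apply: Oq; rewrite OH.
have H1O : H1 `&` O `<=` I by rewrite setIC (leq O I H1) // => x [].
have H1Q : H1 <> Q by move=> H1Q; apply: Qb; rewrite -H1Q; apply: OIH1.
have H1S : H1 <> S by move=> H1S; apply: Sa; rewrite -H1S; apply: OIH1.
have [A' hA' [H1QA' OPA']] : exists2 A', hyperplane M A' & H1 `&` Q `<=` A' /\ O `&` P `<=` A'.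
  apply: (contract_veblen (Vq a Ea ra)) => //; first exact: OIH1.
  by exists I => //; split=> //; rewrite setIC.
have [B' hB' [H1SB' ORB']] : exists2 B', hyperplane M B' & H1 `&` S `<=` B' /\ O `&` R `<=` B'.
  apply: (contract_veblen (Vq b Eb rb)) => //; first exact: OIH1.
  by exists I => //; split=> //; rewrite setIC.
have A'q : A' q by apply: H1QA'.
have B'q : B' q by apply: H1SB'.
have OA' : O <> A' by move=> OA; apply: Oq; rewrite OA.
have OB' : O <> B' by move=> OB; apply: Oq; rewrite OB.
have A'B' : A' <> B'.
  move=> AB; have : (O `&` B') a by split=> //; rewrite -AB; apply: OPA'.
  by rewrite (leq O R B') // => -[].
have QA' : Q <> A' by move=> QA; apply: Qd; rewrite QA; apply: OPA'.
have SB' : S <> B' by move=> SB; apply: Sd; rewrite SB; apply: ORB'.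
(* The lines A'Q and B'S meet in H1, with all hyperplanes through [q]. Hence A'B' and QS meet, and
   A' ∩ B' contains [d] and [d']. *)
have [N' hN' [ABN' QSN']] : exists2 N', hyperplane M N' & A' `&` B' `<=` N' /\ Q `&` S `<=` N'.
  apply: (contract_veblen (Vq q Eq rq)) => //.
  exists H1 => //; split; rewrite setIC.
    rewrite (leq Q H1 A') //; first exact: not_eq_sym.
    by rewrite setIC.
  rewrite (leq S H1 B') //; first exact: not_eq_sym.
  by rewrite setIC.
have N'd : N' d by apply: ABN'; split; [apply: OPA'|apply: ORB'].
have N'd' : N' d' by apply: ABN'; split; [apply: OPA'|apply: ORB'].
have -> // : cl M (Q `&` S `|` [set d]) = N'.
apply: (hyper_eq hN hN'); apply: (cl_sub_flat (hyper_flat hN')).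
by move=> x [/QSN'|->].
Qed.

End KantorStep.

(** * Saturated matroids satisfying the Veblen-Young axiom *)


Section ModularReduction.
Variables (T : Type) (M : matroid T).
Local Notation E := (ground M).
Local Notation r := (rk M).

(** Let Y' be the span of Y and an element of X outside Y. The defect of (X, Y) is the sum of the
    defects of (X, Y') and (X ∩ Y', Y), so one of these is positive. Both pairs have a smaller gap
    between union and intersection, the second because Y' does not yet span X ∪ Y. *)
Lemma nonmodular_split X Y : flat M X -> flat M Y ->
  r (X `|` Y) + r (X `&` Y) < r X + r Y -> (r Y).+1 <> r (X `|` Y) ->
  exists X' Y', [/\ flat M X', flat M Y', r (X' `|` Y') + r (X' `&` Y') < r X' + r Y' &
    r (X' `|` Y') + r (X `&` Y) < r (X `|` Y) + r (X' `&` Y')].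
Proof.
move=> fX fY lt rYJ; have XE := flat_ground fX; have YE := flat_ground fY.
have JE : X `|` Y `<=` E by rewrite subUset.
have [e Xe Ye] : exists2 e, X e & ~ Y e.
  apply: nsub_ex => XY.
  by rewrite (setUidr XY) (setIidl XY) addnC ltnn in lt.
have Ee := XE _ Xe.
pose Y' := cl M (Y `|` [set e]).
have fY' : flat M Y' by apply: flat_cl; apply: sub_ext.
have rY' : r Y' = (r Y).+1 by rewrite /Y' rk_cl ?flat_rkS //; apply: sub_ext.
have YeY' : Y `|` [set e] `<=` Y' := cover_sub YE Ee.
have YY' : Y `<=` Y' by move=> y Yy; apply: YeY'; left.
have Y'e : Y' e by apply: YeY'; right.
have Y'E := flat_ground fY'.
have Y'J : r (X `|` Y') = r (X `|` Y).
  apply/eqP; rewrite eqn_leq; apply/andP; split; last first.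
    by apply: rk_mono; [apply: setUS|rewrite subUset].
  rewrite -(rk_cl JE); apply: rk_mono; last exact: cl_ground.
  rewrite subUset; split; first by apply: subset_trans (sub_cl JE); left.
  apply: cl_mono => //; rewrite subUset; split; first by right.
  by move=> x ->; left.
have XI : X `&` Y' `&` Y = X `&` Y by rewrite -setIA (setIidr YY').
have rX'Y : r (X `&` Y' `|` Y) <= r Y'.
  by apply: rk_mono => //; rewrite subUset; split=> // x [].
have rYJ' : r Y < r (X `|` Y).
  by apply: (flat_rk_lt fY (@subsetUr _ _ _) JE) => H; apply: Ye; apply: H; left.
have rXY' : r (X `&` Y) < r (X `&` Y').
  apply: (flat_rk_lt (flatI fX fY)).
  - by move=> x [Xx /YY'].
  - by move=> x [/XE].
  - by move=> H; apply: Ye; have [] : (X `&` Y) e by apply: H.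
have [lt'|ge'] := ltnP (r (X `&` Y' `|` Y) + r (X `&` Y)) (r (X `&` Y') + r Y).
  exists (X `&` Y'), Y; rewrite XI; split=> //; first exact: flatI.
  lia.
by exists X, Y'; rewrite Y'J; split=> //; lia.
Qed.

Lemma nonmodular_coatoms : ~ modular M -> exists X Y,
  [/\ flat M X, flat M Y, (r X).+1 = r (X `|` Y), (r Y).+1 = r (X `|` Y) &
      (r (X `&` Y)).+2 < r (X `|` Y)].
Proof.
move=> nM; have [X [Y [fX fY lt]]] : exists X Y, [/\ flat M X, flat M Y &
    r (X `|` Y) + r (X `&` Y) < r X + r Y].
  apply: contrapT => H; apply: nM => X Y fX fY; apply: contrapT => mXY; apply: H.
  exists X, Y; split=> //; have := rk_submod (flat_ground fX) (flat_ground fY).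
  by rewrite leq_eqVlt => /orP[/eqP e|//]; case: mXY.
move: {2}(r (X `|` Y) - r (X `&` Y)) (leqnn (r (X `|` Y) - r (X `&` Y))) => n.
elim: n X Y fX fY lt => [|n IH] X Y fX fY lt rn.
  have XE := flat_ground fX; have YE := flat_ground fY.
  have JE : X `|` Y `<=` E by rewrite subUset.
  have := rk_mono (@subsetUl _ X Y) JE; have := rk_mono (@subsetUr _ X Y) JE; lia.
have [rY|rY] := pselect ((r Y).+1 = r (X `|` Y)); last first.
  have [X' [Y' [fX' fY' lt' m']]] := nonmodular_split fX fY lt rY.
  by apply: (IH X' Y') => //; lia.
have [rX|rX] := pselect ((r X).+1 = r (X `|` Y)); last first.
  have lt2 : r (Y `|` X) + r (Y `&` X) < r Y + r X.
    by rewrite [Y `|` X]setUC [Y `&` X]setIC [r Y + _]addnC.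
  rewrite setUC in rX; have [X' [Y' [fX' fY' lt' m']]] := nonmodular_split fY fX lt2 rX.
  by apply: (IH X' Y') => //; move: m' rn; rewrite [Y `|` X]setUC [Y `&` X]setIC; lia.
by exists X, Y; split=> //; lia.
Qed.

(** Closure under modular intersections need only be tested on two covers of a flat. For a modular
    pair A, B with intersection D and x in A outside B, the closure of D ∪ {x} is the intersection
    of A with the closure of B ∪ {x}. That pair is again modular and closer to its intersection, so
    induction puts the cover in [C]. *)
Lemma cut_from_covers C : (forall F, C F -> flat M F) ->
  (forall F G, C F -> flat M G -> F `<=` G -> C G) ->
  (forall D x y, flat M D -> E x -> E y -> ~ D x -> ~ D y ->
    C (cl M (D `|` [set x])) -> C (cl M (D `|` [set y])) ->
    ~ cl M (D `|` [set x]) y -> C D) ->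
  modular_cut M C.
Proof.
move=> Cf Cup Ccov; split=> // F G CF CG mFG.
have [n rn] : exists n, r F + r G < n + r (F `&` G) + r (F `&` G) by exists (r F + r G).+1; lia.
elim: n F G CF CG mFG rn => [|n IH] F G CF CG mFG rn;
  have fF := Cf _ CF; have fG := Cf _ CG;
  have FE := flat_ground fF; have GE := flat_ground fG.
  by have := rk_mono (@subIsetl _ F G) FE; have := rk_mono (@subIsetr _ F G) GE; lia.
have fD := flatI fF fG; have DE := flat_ground fD.
have [FG|FG] := pselect (F `<=` G); first by rewrite (setIidl FG).
have [GF|GF] := pselect (G `<=` F); first by rewrite (setIidr GF).
have [x Fx Gx] := nsub_ex FG; have [y Gy Fy] := nsub_ex GF.
have Ex := FE _ Fx; have Ey := GE _ Gy.
have half A B x' : C A -> C B -> modular_pair M A B -> A x' -> ~ B x' ->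
    A `&` B = F `&` G -> r A + r B = r F + r G -> C (cl M (F `&` G `|` [set x'])).
  move=> CA CB mAB Ax Bx AB rAB.
  have fA := Cf _ CA; have fB := Cf _ CB; have AE := flat_ground fA; have BE := flat_ground fB.
  have Ex' := AE _ Ax.
  pose Bx' := cl M (B `|` [set x']).
  have fBx : flat M Bx' by apply: flat_cl; apply: sub_ext.
  have subB : B `|` [set x'] `<=` Bx' := cover_sub BE Ex'.
  have CBx : C Bx' by apply: Cup CB fBx _ => z Bz; apply: subB; left.
  have rBx : r Bx' = (r B).+1 by rewrite /Bx' rk_cl ?flat_rkS //; apply: sub_ext.
  have Dx : ~ (F `&` G) x' by rewrite -AB => -[].
  have Dsub : cl M (F `&` G `|` [set x']) `<=` A `&` Bx'.
    apply: cl_sub_flat (flatI fA fBx) _; rewrite -AB => z [[Az Bz]|->].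
      by split=> //; apply: subB; left.
    by split=> //; apply: subB; right.
  have rDx : r (cl M (F `&` G `|` [set x'])) = (r (F `&` G)).+1.
    by rewrite rk_cl ?flat_rkS //; apply: sub_ext.
  have ABE : A `|` B `<=` E by rewrite subUset.
  have rABx : r (A `|` B) <= r (A `|` Bx').
    by apply: rk_mono; [apply: setUS => z Bz; apply: subB; left|rewrite subUset; split=> //; apply: flat_ground].
  have IE : A `&` Bx' `<=` E by move=> z [/AE].
  have rI : r (A `&` Bx') <= (r (F `&` G)).+1.
    have := rk_submod AE (flat_ground fBx); move: mAB; rewrite /modular_pair AB rBx; lia.
  have eD : cl M (F `&` G `|` [set x']) = A `&` Bx'.
    apply/seteqP; split=> //; apply: (flat_max (flat_cl (sub_ext DE Ex')) Dsub IE).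
    by rewrite rDx.
  rewrite eD; apply: IH => //.
    have := rk_submod AE (flat_ground fBx); rewrite -eD rDx rBx.
    have := rk_mono Dsub IE; rewrite rDx.
    have : r (A `|` Bx') <= r (A `|` B).
      rewrite -(rk_cl ABE); apply: rk_mono; last exact: cl_ground.
      rewrite subUset; split; first by apply: subset_trans (sub_cl ABE); left.
      by apply: cl_mono => //; rewrite subUset; split=> [z Bz|z ->]; [right|left].
    by move: mAB; rewrite /modular_pair AB -eD rDx rBx; lia.
  by rewrite -eD rDx rBx; lia.
apply: (Ccov _ x y fD) => //; try by case.
- exact: (half F G).
- apply: (half G F) => //; [|by rewrite setIC|by rewrite addnC].
  by move: mFG; rewrite /modular_pair addnC setUC setIC.
- move=> cy; apply: Fy; apply: (cl_sub_flat fF _ cy).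
  by move=> z [[]|->].
Qed.

End ModularReduction.

Section Subspaces.
Variables (T : Type) (M : matroid T).
Local Notation E := (ground M).
Local Notation r := (rk M).
Implicit Types S W : set (set T).

Definition subspace S := (forall H, S H -> hyperplane M H) /\
  forall H1 H2 H, S H1 -> S H2 -> H1 <> H2 -> hyperplane M H -> H1 `&` H2 `<=` H -> S H.

Definition cut_of S := [set F | flat M F /\ forall H, hyperplane M H -> F `<=` H -> S H].

Lemma cut_of_hyperplane S H : hyperplane M H -> cut_of S H <-> S H.
Proof.
move=> hH; split=> [[_]|SH]; first by apply.
by split=> [|H' hH' /(hyper_eq hH hH') <- //]; apply: hyper_flat.
Qed.

(** A hyperplane H above D missing x and y is put on a dual line of S: if a flat A of corank 2 with
    D ⊆ A ⊆ H does not span y together with x, then the closures of A ∪ {x} and A ∪ {y} are distinct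
    members of S meeting in A. *)
Lemma subspace_modular_cut S : subspace S -> modular_cut M (cut_of S).
Proof.
move=> [Sh Sl]; apply: cut_from_covers => [F []//|F G [fF FS] fG FG|D x y fD Ex Ey Dx Dy [fx Sx] [fy Sy] nxy].
  by split=> // H hH GH; apply: FS => //; apply: subset_trans GH.
split=> // H hH DH; apply: contrapT => SH.
have DE := flat_ground fD; have HE := hyper_ground hH; have rH := hyper_rk hH.
have Hx : ~ H x by move=> Hx; apply: SH; apply: Sx => //; apply: (cl_sub_flat (hyper_flat hH)) => z [/DH|->].
have Hy : ~ H y by move=> Hy; apply: SH; apply: Sy => //; apply: (cl_sub_flat (hyper_flat hH)) => z [/DH|->].
have rDx : r (D `|` [set x]) = (r D).+1 by rewrite flat_rkS.
have rDR : (r D).+2 <= r E.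
  rewrite ltnNge; apply/negP => le; apply: nxy.
  by apply: (@cl_min _ _ _ E) => //; [apply: sub_ext|rewrite rDx].
(* If H is not in S, no such A exists. The induction, on the corank of A, carries this from corank 2
   down to D, contradicting [nxy]. *)
suff claim n A : flat M A -> D `<=` A -> A `<=` H -> (r A).+2 <= r E ->
    r E <= n + (r A).+2 -> cl M (A `|` [set x]) y.
  by apply: nxy; apply: (claim (r E) D) => //; lia.
elim: n A => [|n IH] A fA DA AH rAE rn; apply: contrapT => ny.
  have rA : (r A).+2 = r E by lia.
  have AE := flat_ground fA.
  have hHx := coline_cl_hyper fA rA Ex (contra_not (@AH x) Hx).
  have hHy := coline_cl_hyper fA rA Ey (contra_not (@AH y) Hy).
  have subx := cover_sub AE Ex; have suby := cover_sub AE Ey.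
  have Hxy : cl M (A `|` [set x]) <> cl M (A `|` [set y]).
    by move=> e; apply: ny; rewrite e; apply: suby; right.
  apply: SH; apply: (Sl _ _ _ _ _ Hxy) => //.
  - by apply: Sx => //; apply: cl_mono; [apply: setSU|apply: sub_ext].
  - by apply: Sy => //; apply: cl_mono; [apply: setSU|apply: sub_ext].
  apply: subset_trans AH; apply: (flat_max fA).
  - by move=> z Az; split; [apply: subx|apply: suby]; left.
  - by move=> z [/(hyper_ground hHx)].
  have fI := hyperI_flat hHx hHy.
  have := flat_rk_lt fI (@subIsetl _ _ _) (hyper_ground hHx).
  have nI : ~ cl M (A `|` [set x]) `<=` cl M (A `|` [set x]) `&` cl M (A `|` [set y]).
    by move=> H'; apply: (hyper_neq hHx hHy Hxy) => z /H'[].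
  by move=> /(_ nI); have := hyper_rk hHx; lia.
have AE := flat_ground fA; have Ax := contra_not (@AH x) Hx.
have [rA|rA] := eqVneq (r A).+2 (r E).
  by apply: ny; apply: IH => //; lia.
have nHA : ~ H `<=` A by move=> HA; have := rk_mono HA AE; lia.
have [a Ha Aa] := nsub_ex nHA; have Ea := HE _ Ha.
have AaE := sub_ext AE Ea; have rAa := flat_rkS fA Ea Aa.
have AaH : A `|` [set a] `<=` H by move=> z [/AH|->].
have [|b Hb nb] := ex_notin_cl AaE HE; first lia.
have Eb := HE _ Hb; have rAab := notin_cl_rkS AaE Eb nb.
have Ab : ~ A b by move=> Ab; apply: nb; apply: sub_cl => //; left.
have cov c : H c -> ~ A c -> r (A `|` [set c] `|` [set x] `|` [set y]) = (r A).+2.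
  move=> Hc Ac; have Ec := HE _ Hc; have AcE := sub_ext AE Ec.
  have rAc := flat_rkS fA Ec Ac.
  have AcH : A `|` [set c] `<=` H by move=> z [/AH|->].
  have cAcH := cl_sub_flat (hyper_flat hH) AcH.
  have [] : cl M (cl M (A `|` [set c]) `|` [set x]) y.
    apply: IH; [exact: flat_cl|by apply: subset_trans (sub_cl AcE) => z /DA; left|by []| |].
      by rewrite rk_cl // rAc; lia.
    by rewrite rk_cl // rAc; lia.
  move=> _ ry; have cE : cl M (A `|` [set c]) `|` [set x] `<=` E.
    by apply: sub_ext => //; apply: cl_ground.
  apply/eqP; rewrite eqn_leq; apply/andP; split.
    have : r (cl M (A `|` [set c]) `|` [set x] `|` [set y]) = (r A).+2.
      by rewrite ry flat_rkS ?rk_cl ?rAc //; [apply: flat_cl|move=> /cAcH].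
    move=> <-; apply: rk_mono; last exact: sub_ext.
    by do 2 apply: setSU; apply: sub_cl.
  have nx : ~ cl M (A `|` [set c]) x by move=> /cAcH.
  rewrite -rAc -(notin_cl_rkS AcE Ex nx); apply: rk_mono; first by left.
  by do 2 apply: sub_ext => //.
have ra := cov a Ha Aa; have rb := cov b Hb Ab.
have nx : ~ cl M (A `|` [set a] `|` [set b]) x.
  by move=> c; apply: Hx; apply: (cl_sub_flat (hyper_flat hH) _ c) => z [/AaH|->].
have rabx := notin_cl_rkS (sub_ext AaE Eb) Ex nx.
have AxE := sub_ext AE Ex.
have rAxy := notin_cl_rkS AxE Ey ny.
have rAx := flat_rkS fA Ex Ax.
(* By induction y is spanned by A, a, x and by A, b, x. If A, x did not span y, both sets would have
   rank rk A + 2 and share a subset of that rank, although their union has rank at least rk A +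
   3. *)
have := @rk_le2 _ M (A `|` [set a] `|` [set x] `|` [set y]) (A `|` [set b] `|` [set x] `|` [set y])
  (A `|` [set a] `|` [set b] `|` [set x]) (A `|` [set x] `|` [set y]).
have EaE c : E c -> A `|` [set c] `|` [set x] `|` [set y] `<=` E.
  by move=> Ec; do 3 apply: sub_ext => //.
move=> /(_ (EaE _ Ea) (EaE _ Eb)).
have H1 : A `|` [set a] `|` [set b] `|` [set x] `<=`
  A `|` [set a] `|` [set x] `|` [set y] `|` (A `|` [set b] `|` [set x] `|` [set y]).
  by clear; sset.
have H2 : A `|` [set x] `|` [set y] `<=` (A `|` [set a] `|` [set x] `|` [set y]) `&`
  (A `|` [set b] `|` [set x] `|` [set y]) by clear; sset.
by move=> /(_ H1 H2); lia.
Qed.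

Lemma hyperplanes_above_subspace X : subspace [set H | hyperplane M H /\ X `<=` H].
Proof.
split=> [H []//|H1 H2 H [h1 X1] [h2 X2] _ hH sub].
by split=> // x Xx; apply: sub; split; [apply: X1|apply: X2].
Qed.

Lemma maximal_subspace W H0 : subspace W -> ~ W H0 -> exists S,
  [/\ subspace S, W `<=` S, ~ S H0 &
      forall S', subspace S' -> S `<=` S' -> ~ S' H0 -> S' `<=` S].
Proof.
move=> sW WH0.
(* Putting W into the property lets the empty chain satisfy it. *)
pose P S := subspace (W `|` S) /\ ~ (W `|` S) H0.
have [|A [[sA AH0] Amax]] := @Zorn_bigcup _ P.
- move=> F FP totF; split; last first.
    by move=> [//|[S FS SH]]; case: (FP _ FS) => _; apply; right.
  have [chain Fh] : (forall H1 H2, (W `|` \bigcup_(S in F) S) H1 -> (W `|` \bigcup_(S in F) S) H2 ->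
      (W H1 /\ W H2) \/ exists2 S, F S & (W `|` S) H1 /\ (W `|` S) H2) /\
      (forall H, (W `|` \bigcup_(S in F) S) H -> hyperplane M H).
    split.
      move=> H1 H2 [W1|[S1 F1 S1H]] [W2|[S2 F2 S2H]].
      - by left.
      - by right; exists S2 => //; exact: (conj (or_introl W1) (or_intror S2H)).
      - by right; exists S1 => //; exact: (conj (or_intror S1H) (or_introl W2)).
      - case: (totF _ _ F1 F2) => S12; right.
          by exists S2 => //; exact: (conj (or_intror (S12 _ S1H)) (or_intror S2H)).
        by exists S1 => //; exact: (conj (or_intror S1H) (or_intror (S12 _ S2H))).
    move=> H [WH|[S FS SH]]; first by case: sW => + _; apply.
    by case: (FP _ FS) => -[+ _] _; apply; right.
  split=> // H1 H2 H /chain c /c [[W1 W2]|[S FS [S1 S2]]] H12 hH sub.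
    by left; case: sW => _ /(_ H1 H2); apply.
  have [[_ Sl] _] := FP _ FS.
  have [WH|SH] := Sl H1 H2 H S1 S2 H12 hH sub; first by left.
  by right; exists S.
exists (W `|` A); split=> //.
move=> S' sS' WS' S'H0 H S'H; apply: contrapT => WAH.
apply: (Amax S'); last first.
  by rewrite /P (setUidr (subset_trans (@subsetUl _ W A) WS')).
split; first by move=> B AB; apply: WS'; right.
by move=> S'A; apply: WAH; right; apply: S'A.
Qed.

Hypotheses (hM : hypermodular M) (V : veblen M).

Section Join.
Variables (S : set (set T)) (p : set T).
Hypotheses (sS : subspace S) (hp : hyperplane M p) (Sp : ~ S p).

Definition join := [set H | hyperplane M H /\ exists v, [/\ S v, v <> p & v `&` p `<=` H]].

Let Sh H : S H -> hyperplane M H. Proof. by case: sS => + _; apply. Qed.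
Let S_neq H : S H -> H <> p. Proof. by move=> SH Hp; apply: Sp; rewrite -Hp. Qed.

Lemma sub_join : S `<=` join.
Proof. by move=> H SH; split; [apply: Sh|exists H; split=> //; apply: S_neq]. Qed.

(** Let v in S be on the line p H2. The lines H w and p v meet in H2, so by [veblen] H p and w v
    meet, in a point of S; hence H lies on a line from p to S. *)
Lemma join_step w H2 H : S w -> join H2 -> w <> H2 -> hyperplane M H -> w `&` H2 `<=` H -> join H.
Proof.
move=> Sw [h2 [v [Sv vp vp2]]] w2 hH sub; split=> //.
have hw := Sh Sw; have hv := Sh Sv.
have [->|Hp] := pselect (H = p); first by exists v; split=> // x [].
have [->|Hw] := pselect (H = w); first by exists w; split=> //; apply: S_neq.
have [wv|wv] := pselect (w = v).
  by exists v; split=> //; rewrite -(line_eq hM hv hp h2) // -wv.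
have [|v' hv' [Hpv' wvv']] := V hH hw hp hv Hp wv.
  exists H2 => //; split; last by rewrite setIC.
  by rewrite setIC (line_eq hM hw h2 hH) //; apply: not_eq_sym.
have Sv' : S v' by case: sS => _ /(_ w v); apply.
have v'p := S_neq Sv'.
exists v'; split=> //; rewrite setIC (line_eq hM hp hH hv').
- by move=> x [].
- exact: not_eq_sym.
- exact: not_eq_sym.
- by rewrite setIC.
Qed.

(** If H1, H2 are on the lines p v1, p v2, then H1 v1 and H2 v2 meet in p, so H1 H2 meets v1 v2 in a
    point of S. This reduces the claim to [join_step]. *)
Lemma join_subspace : subspace join.
Proof.
split=> [H []//|H1 H2 H j1 j2 H12 hH sub].
have [S1|S1] := pselect (S H1); first exact: (join_step S1 j2).
have [S2|S2] := pselect (S H2).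
  by apply: (join_step S2 j1) => //; [exact: not_eq_sym|rewrite setIC].
have [h1 [v1 [Sv1 v1p sub1]]] := j1; have [h2 [v2 [Sv2 v2p sub2]]] := j2.
have hv1 := Sh Sv1; have hv2 := Sh Sv2.
have [v12|v12] := pselect (v1 = v2).
  split=> //; exists v1; split=> // x vx; apply: sub.
  by split; [apply: sub1|apply: sub2; rewrite -v12].
have n1 : v1 <> H1 by move=> e; apply: S1; rewrite -e.
have n2 : v2 <> H2 by move=> e; apply: S2; rewrite -e.
have [|w hw [w1 w2]] := V h1 hv1 h2 hv2 H12 v12.
  exists p => //; split; rewrite setIC.
    by rewrite (line_eq hM hv1 hp h1) // => x [].
  by rewrite (line_eq hM hv2 hp h2) // => x [].
have Sw : S w by case: sS => _ /(_ v1 v2); apply.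
have wH2 : w <> H2 by move=> e; apply: S2; rewrite -e.
apply: (join_step Sw j2) => //.
rewrite setIC (line_eq hM h2 h1 hw); [by rewrite setIC|exact: not_eq_sym|exact: not_eq_sym|].
by rewrite setIC.
Qed.

End Join.

(** For x outside S, the join of S and x contains H0 by maximality, so the line x H0 meets S. Doing
    this for P and Q gives v1, v2 in S, and [veblen] makes PQ meet v1 v2. *)
Lemma maximal_subspace_meets_lines S H0 : subspace S -> S !=set0 -> hyperplane M H0 -> ~ S H0 ->
  (forall S', subspace S' -> S `<=` S' -> ~ S' H0 -> S' `<=` S) ->
  forall P Q, hyperplane M P -> hyperplane M Q -> P <> Q -> exists2 v, S v & P `&` Q `<=` v.
Proof.
move=> sS [v0 Sv0] h0 SH0 Smax P Q hP hQ PQ.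
have Sh H : S H -> hyperplane M H by case: sS => + _; apply.
have [SP|SP] := pselect (S P); first by exists P => // x [].
have [SQ|SQ] := pselect (S Q); first by exists Q => // x [].
have reach x : hyperplane M x -> ~ S x -> x <> H0 ->
    exists v, [/\ S v, hyperplane M v, v <> H0, v <> x & v `&` x = v `&` H0].
  move=> hx Sx xH0; have [v [Sv vx vxH0]] : exists v, [/\ S v, v <> x & v `&` x `<=` H0].
    apply: contrapT => no; have jx : join S x x.
      by split=> //; exists v0; split=> // e; apply: Sx; rewrite -e.
    apply: (Sx); apply: (Smax (join S x)) => //; [exact: join_subspace|exact: sub_join|].
    by move=> [_ [v vP]]; apply: no; exists v.
  have hv := Sh _ Sv; have vH0 : v <> H0 by move=> e; apply: SH0; rewrite -e.
  by exists v; split=> //; rewrite (line_eq hM hv hx h0).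
have [PH0|PH0] := pselect (P = H0).
  have QH0 : Q <> H0 by move=> e; apply: PQ; rewrite e.
  have [v [Sv hv vH0 vQ e]] := reach Q hQ SQ QH0; exists v => //.
  rewrite PH0 setIC (line_eq hM hQ hv h0) //; first exact: not_eq_sym.
  by rewrite setIC e => x [].
have [QH0|QH0] := pselect (Q = H0).
  have [v [Sv hv vH0 vP e]] := reach P hP SP PH0; exists v => //.
  rewrite QH0 (line_eq hM hP hv h0) //; first exact: not_eq_sym.
  by rewrite setIC e => x [].
have [v1 [Sv1 hv1 v1H0 v1P e1]] := reach P hP SP PH0.
have [v2 [Sv2 hv2 v2H0 v2Q e2]] := reach Q hQ SQ QH0.
have [v12|v12] := pselect (v1 = v2).
  exists v1 => //; rewrite -v12 in e2 v2Q.
  rewrite (line_eq hM hP hv1 hQ) //; first exact: not_eq_sym.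
  by rewrite setIC e1 -e2 => x [].
have [|v hv [PQv v12v]] := V hP hv1 hQ hv2 PQ v12.
  by exists H0 => //; split; rewrite setIC ?e1 ?e2 => x [].
by exists v => //; case: sS => _ /(_ v1 v2); apply.
Qed.

(** For a non-modular pair as in [nonmodular_coatoms], all hyperplanes above X or Y lie in one
    subspace that misses some H0 above X ∩ Y. A maximal such subspace gives a good cut, principal by
    saturation; its generator is contained in X ∩ Y, hence in H0, which puts H0 into the
    subspace. *)
Theorem veblen_saturated_modular : saturated M -> modular M.
Proof.
move=> satM; apply: contrapT => /nonmodular_coatoms[X [Y [fX fY rX rY rK]]].
have XE := flat_ground fX; have YE := flat_ground fY.
have JE : X `|` Y `<=` E by rewrite subUset.
have KE : X `&` Y `<=` E by move=> x [/XE].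
have rJE := rk_leE JE.
have XK : ~ X `<=` X `&` Y by move=> /rk_mono/(_ KE); lia.
have [x1 Xx1 Kx1] := nsub_ex XK.
have Yx1 : ~ Y x1 by move=> Yx; apply: Kx1.
have Ex1 := XE _ Xx1.
have [p [hp Yp px1]] := hyper_avoid YE Ex1 (contra_not (@cl_sub_flat _ _ _ _ fY (@subset_refl _ Y) x1) Yx1).
pose SX := [set H | hyperplane M H /\ X `<=` H].
have sSX : subspace SX := hyperplanes_above_subspace X.
have SXp : ~ SX p by move=> [_ Xp]; apply/px1/Xp.
have sW := join_subspace sSX hp SXp.
have SXW := sub_join sSX SXp.
have XYJ H : Y `<=` H -> H x1 -> flat M H -> X `<=` H.
  move=> YH Hx fH; apply: subset_trans (cl_sub_flat fH (_ : Y `|` [set x1] `<=` H)); last first.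
    by move=> y [/YH|->].
  apply: subset_trans (@subsetUl _ X Y) _; apply: cl_min => //.
    by move=> y [|->]; [right|left].
  by rewrite flat_rkS // rY.
have YW H : hyperplane M H -> Y `<=` H -> join SX p H.
  move=> hH YH; split=> //.
  have [Hp|Hp] := pselect (H = p).
    have [|H' hH' XH'] := hyper_ex XE; first lia.
    exists H'; split=> //; first by move=> e; apply: px1; rewrite -e; apply: XH'.
    by rewrite Hp => x [].
  have fG := hyperI_flat hH hp; have rG := hyperI_rk hM hH hp Hp.
  have Gx1 : ~ (H `&` p) x1 by case.
  have hv := coline_cl_hyper fG rG Ex1 Gx1.
  have sub := cover_sub (flat_ground fG) Ex1.
  set v := cl M _ in hv sub.
  have vx1 : v x1 by apply: sub; right.
  have vp : v <> p by move=> e; apply: px1; rewrite -e.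
  exists v; split=> //.
    split=> //; apply: XYJ (hyper_flat hv) => // y Yy; apply: sub; left.
    by split; [apply: YH|apply: Yp].
  rewrite setIC (line_eq hM hp hH hv) //; [exact: not_eq_sym|exact: not_eq_sym|].
  by move=> x [Px Hx]; apply: sub; left.
(* X ∩ Y has corank at least 2 in X, so some hyperplane H contains X ∩ Y and x1 but not X. If v
   above X had v ∩ p inside H, then v ∩ H = v ∩ p would contain x1, which p avoids. *)
have [H0 [hH0 KH0 WH0]] : exists H0, [/\ hyperplane M H0, X `&` Y `<=` H0 & ~ join SX p H0].
  apply: contrapT => no.
  have K1E := sub_ext KE Ex1.
  have rK1 := flat_rkS (flatI fX fY) Ex1 Kx1.
  have [|x2 Xx2 K1x2] := ex_notin_cl K1E XE; first lia.
  have [H [hH K1H Hx2]] := hyper_avoid K1E (XE _ Xx2) K1x2.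
  apply: no; exists H; split=> //; first by move=> x Kx; apply: K1H; left.
  move=> [_ [v [[hv Xv] vp vpH]]].
  have vH : v <> H by move=> e; apply: Hx2; rewrite -e; apply: Xv.
  have vHp : v `&` H = v `&` p := line_eq hM hv hp hH vp vH vpH.
  have : (v `&` H) x1 by split; [apply: Xv|apply: K1H; right].
  by rewrite vHp => -[].
have [S [sS WS SH0 Smax]] := maximal_subspace sW WH0.
have Sh H : S H -> hyperplane M H by case: sS => + _; apply.
have S0 : S !=set0.
  have [|H' hH' XH'] := hyper_ex XE; first lia.
  by exists H'; apply/WS/SXW.
have lines := maximal_subspace_meets_lines sS S0 hH0 SH0 Smax.
have gS : good_cut M (cut_of S).
  move=> G fG rG; have GE := flat_ground fG.
  have [|e Ee ne] := ex_notin_cl GE (@subset_refl _ E); first lia.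
  have Ge : ~ G e by move=> Ge; apply: ne; apply: sub_cl.
  have hP := coline_cl_hyper fG rG Ee Ge.
  have sub := cover_sub GE Ee.
  have [Q [hQ GQ Qe]] := hyper_avoid GE Ee ne.
  have PQ : cl M (G `|` [set e]) <> Q by move=> eq; apply: Qe; rewrite -eq; apply: sub; right.
  have [v Sv PQv] := lines _ _ hP hQ PQ; have hv := Sh _ Sv.
  exists v; split=> //; first by apply/cut_of_hyperplane.
  by move=> x Gx; apply: PQv; split; [apply: sub; left|apply: GQ].
have [|F [fF CF FC]] := principalP (satM _ (subspace_modular_cut sS) _ gS).
  by case: S0 => H SH; exists H; apply/cut_of_hyperplane => //; apply: Sh.
have FX : F `<=` X by apply: FC; split=> // H hH XH; apply/WS/SXW.
have FY : F `<=` Y by apply: FC; split=> // H hH YH; apply/WS/YW.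
have FH0 : F `<=` H0 by move=> x Fx; apply: KH0; split; [apply: FX|apply: FY].
by apply: SH0; case: CF => _; apply.
Qed.

End Subspaces.

(** * Extensions by modular cuts *)


Lemma finite_subsets (T : Type) (A : set T) : finite_set A -> finite_set [set B | B `<=` A].
Proof.
move=> fA; elim/finite_set_indU: A / fA => [|A a _ IH].
  by apply: sub_finite_set (finite_set1 set0) => B /= B0; rewrite -subset0.
have fI : finite_set [set B `|` [set a] | B in [set B | B `<=` A]] by apply: finite_image.
apply: (@sub_finite_set _ _ ([set B | B `<=` A] `|` [set B `|` [set a] | B in [set B | B `<=` A]])).
  move=> B /= BA; have [Ba|Ba] := pselect (B a); [right|left].
    exists (B `\ a); last exact: setD1U.
    by move=> x [Bx xa]; case: (BA _ Bx) => // /xa.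
  by move=> x Bx; case: (BA _ Bx) => // xa; case: Ba; rewrite -xa.
by rewrite finite_setU.
Qed.

Lemma finite_maximal (T : Type) (D : set T) (F : set (set T)) : finite_set D ->
  (forall A, F A -> A `<=` D) -> F !=set0 ->
  exists A, F A /\ forall B, F B -> A `<=` B -> B `<=` A.
Proof.
move=> fD; elim/finite_set_indU: D / fD F => [|D a _ IH] F FD [A0 FA0].
  by exists A0; split=> // B /FD B0 _ x /B0.
have [[A [FA Aa]]|no] := pselect (exists A, F A /\ A a); last first.
  apply: IH; last by exists A0.
  move=> A FA x Ax; case: (FD _ FA _ Ax) => // xa.
  by case: no; exists A; rewrite -xa.
have [||B [[Ba FB] Bmax]] := IH [set B | ~ B a /\ F (B `|` [set a])].
- move=> B [Ba FB] x Bx; case: (FD _ FB x); [by left|by []|].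
  by move=> xa; case: Ba; rewrite -xa.
- by exists (A `\ a); split; [move=> [_]; apply|rewrite setD1U].
exists (B `|` [set a]); split=> // C FC BC x Cx.
have Ca : C a by apply: BC; right.
have [->|xa] := pselect (x = a); first by right.
left; apply: (Bmax (C `\ a)) => //.
  by split; [move=> [_]; apply|rewrite setD1U].
by move=> y By; split; [apply: BC; left|move=> ya; apply: Ba; rewrite -ya].
Qed.

Section CutExtension.
Variables (T : Type) (M : matroid T) (C : set (set T)).
Hypotheses (cC : modular_cut M C) (C0 : C !=set0).
Local Notation E := (ground M).
Local Notation r := (rk M).

Lemma cut_ground : C E.
Proof.
case: C0 => F CF; case: cC => Cf Cup _.
by apply: (Cup _ _ CF (flat_groundM M)); apply: flat_ground; apply: Cf.
Qed.

(** A flat of corank at least 2 is the intersection of two covers forming a modular pair, so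
    induction on the corank applies. A non-empty modular cut is thus determined by its
    hyperplanes. *)
Lemma cut_from_hyperplanes F : flat M F ->
  (forall H, hyperplane M H -> F `<=` H -> C H) -> C F.
Proof.
case: cC => Cf Cup CI; have [n rn] : exists n, r E <= n + r F by exists (r E); lia.
elim: n F rn => [|n IH] F rn fF CF; have FE := flat_ground fF.
  suff -> : F = E by exact: cut_ground.
  by apply/seteqP; split=> //; apply: (flat_max fF) => //; lia.
have [rF|rF] := leqP (r E) (n + r F); first exact: IH.
have [n0|n0] := eqVneq n 0.
  by apply: CF => //; split=> //; lia.
have up x : E x -> ~ F x -> [/\ C (cl M (F `|` [set x])), F `|` [set x] `<=` cl M (F `|` [set x]) & r (cl M (F `|` [set x])) = (r F).+1].
  move=> Ex Fx; have sub := cover_sub FE Ex.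
  have rx : r (cl M (F `|` [set x])) = (r F).+1 by rewrite rk_cl ?flat_rkS //; apply: sub_ext.
  split=> //; apply: IH; [lia|by apply: flat_cl; apply: sub_ext|].
  by move=> H hH FH; apply: CF => // y Fy; apply/FH/sub; left.
have [|x Ex nx] := ex_notin_cl FE (@subset_refl _ E); first lia.
have Fx := contra_not (@sub_cl _ _ _ FE x) nx.
have [C1 sub1 r1] := up x Ex Fx; have FxE := sub_ext FE Ex.
have [|y Ey ny] := ex_notin_cl FxE (@subset_refl _ E).
  by rewrite flat_rkS //; lia.
have Fy : ~ F y by move=> Fy; apply: ny; apply: sub1; left.
have [C2 sub2 r2] := up y Ey Fy.
set F1 := cl M (F `|` [set x]) in C1 sub1 r1; set F2 := cl M (F `|` [set y]) in C2 sub2 r2.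
have F1E := flat_ground (Cf _ C1); have F2E := flat_ground (Cf _ C2).
have UE : F1 `|` F2 `<=` E by rewrite subUset.
have IE : F1 `&` F2 `<=` E by move=> z [/F1E].
have FI : F `<=` F1 `&` F2 by move=> z Fz; split; [apply: sub1|apply: sub2]; left.
have rU : (r F).+2 <= r (F1 `|` F2).
  have := notin_cl_rkS FxE Ey ny; rewrite (flat_rkS fF Ex Fx) => <-.
  apply: rk_mono => // z [/sub1|->]; first by left.
  by right; apply: sub2; right.
have rI := rk_mono FI IE.
have := rk_submod F1E F2E => sm.
have <- : F1 `&` F2 = F.
  by apply/seteqP; split=> //; apply: (flat_max fF FI IE); lia.
by apply: CI => //; rewrite /modular_pair; lia.
Qed.

Hypothesis C_loops : ~ C (cl M set0).

(** This is the elementary quotient of the cut; lifting it by one element is Crapo's single-element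
    extension. By [C_loops] the subtraction never truncates. *)
Definition cut_rk A := r A - `[< C (cl M A) >].

Lemma cut_cl_mono A B : A `<=` B -> B `<=` E -> C (cl M A) -> C (cl M B).
Proof.
case: cC => _ Cup _ AB BE CA.
by apply: Cup CA (flat_cl BE) _; apply: cl_mono.
Qed.

Lemma cl_eq A B : A `<=` B -> B `<=` E -> r B <= r A -> cl M A = cl M B.
Proof.
move=> AB BE rBA; have AE := subset_trans AB BE.
apply/seteqP; split; first exact: cl_mono.
by apply: cl_sub_flat (flat_cl AE) _; apply: cl_min.
Qed.

Lemma cut_rkE A : A `<=` E -> cut_rk A + `[< C (cl M A) >] = r A.
Proof.
move=> AE; rewrite /cut_rk; case: asboolP => [CA|]; last by rewrite subn0 addn0.
rewrite subnK // lt0n; apply/eqP => rA; apply: C_loops.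
by rewrite (@cl_eq set0 A) // rA.
Qed.

Lemma cut_quotient : quotient_rank M cut_rk 1.
Proof.
split.
- move=> A B AB BE; have AE := subset_trans AB BE.
  have := cut_rkE AE; have := cut_rkE BE; have := rk_mono AB BE.
  have : C (cl M A) -> C (cl M B) by apply: cut_cl_mono.
  have : r B <= r A -> cl M A = cl M B by apply: cl_eq.
  case: (leqP (r B) (r A)) => [rBA /(_ isT) -> _|rAB _ _]; first lia.
  by case: asbool; case: asbool; lia.
- move=> A B AE BE.
  have JE : A `|` B `<=` E by rewrite subUset.
  have KE : A `&` B `<=` E by move=> x [/AE].
  have := cut_rkE AE; have := cut_rkE BE; have := cut_rkE JE; have := cut_rkE KE.
  have := rk_submod AE BE.
  have : C (cl M A) -> C (cl M (A `|` B)) by apply: cut_cl_mono.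
  have : C (cl M B) -> C (cl M (A `|` B)) by apply: cut_cl_mono.
  case: (asboolP (C (cl M A))) => CA; case: (asboolP (C (cl M B))) => CB;
  case: (asboolP (C (cl M (A `|` B)))) => CJ; case: (asboolP (C (cl M (A `&` B)))) => CK //=;
    rewrite ?addn0 ?addn1 => ab aj; try (by case: (CJ (ab CB))); try (by case: (CJ (aj CA))); try lia.
  (* In the critical case the closures of A and B belong to the cut and that of A ∩ B does not. If
     the ranks were modular, the closure of A ∩ B would be the intersection of the two closures and
     belong to the cut. *)
  move=> sm eK eJ eB eA; suff : r (A `|` B) + r (A `&` B) <> r A + r B by lia.
  move=> mAB; apply: CK; case: cC => _ _ CI.
  have cAE := @cl_ground _ M A; have cBE := @cl_ground _ M B.
  have rcJ : r (A `|` B) <= r (cl M A `|` cl M B).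
    apply: rk_mono; last by rewrite subUset.
    by move=> x [/(sub_cl AE)|/(sub_cl BE)]; [left|right].
  have cKI : cl M (A `&` B) `<=` cl M A `&` cl M B.
    by move=> x cx; split; apply: cl_mono cx => // y [].
  have IE : cl M A `&` cl M B `<=` E by move=> x [/cAE].
  have rI := rk_mono cKI IE; rewrite rk_cl // in rI.
  have := rk_submod cAE cBE; rewrite !rk_cl // => sm'.
  have -> : cl M (A `&` B) = cl M A `&` cl M B.
    apply/seteqP; split=> //; apply: (flat_max (flat_cl KE) cKI IE).
    by rewrite rk_cl //; lia.
  by apply: CI => //; rewrite /modular_pair !rk_cl //; lia.
- move=> A B AB BE; have AE := subset_trans AB BE.
  have := cut_rkE AE; have := cut_rkE BE.
  have : C (cl M A) -> C (cl M B) by apply: cut_cl_mono.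
  by case: asboolP => CB; case: asboolP => CA //= AB'; try lia; case: (CB (AB' CA)).
- move=> A AE; have := cut_rkE AE; by case: asbool; lia.
Qed.

Variable u : T.
Hypotheses (finM : finite_matroid M) (uE : ~ E u).

Let zE i : i < 1 -> ~ E u. Proof. by []. Qed.
Let z_inj i j : i < 1 -> j < 1 -> u = u -> i = j. Proof. by lia. Qed.

Definition cut_ext : matroid T := @higgs T M cut_rk 1 (fun _ => u) finM cut_quotient zE z_inj.

Lemma new_elts1 : new_elts 1 (fun _ => u) = [set u].
Proof. by apply/seteqP; split=> [_ [i _ <-]//|x ->]; exists 0. Qed.

Lemma cut_ext_ground : ground cut_ext = E `|` [set u].
Proof. by rewrite /= new_elts1. Qed.

Lemma cut_ext_restricts : restricts_to cut_ext M.
Proof. exact: higgs_restricts. Qed.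

Lemma cut_ext_rk A : A `<=` E -> rk cut_ext (A `|` [set u]) + `[< C (cl M A) >] = (r A).+1.
Proof.
move=> AE; rewrite -new_elts1 rk_higgs_all //.
by have := cut_rkE AE; case: asbool; lia.
Qed.

Lemma cut_ext_finite : finite_matroid cut_ext.
Proof. exact: higgs_finite. Qed.

Lemma cut_ext_cl A : A `<=` E -> cl cut_ext A u <-> C (cl M A).
Proof.
move=> AE; have := cut_ext_rk AE.
have <- : rk cut_ext A = r A by case: cut_ext_restricts => _; apply.
case: asboolP => CA e; split=> //.
  move=> _; split; first by rewrite cut_ext_ground; right.
  by move: e; rewrite /= addn1 => -[].
by move=> [_ ru]; move: e; rewrite ru addn0; lia.
Qed.

End CutExtension.

Lemma flat_trace (T : Type) (N M : matroid T) F :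
  restricts_to N M -> flat N F -> flat M (F `&` ground M).
Proof.
move=> [EN rN] fF; apply/flatE; split; first by move=> x [].
move=> x [Ex rx]; split=> //.
have FE : F `&` ground M `<=` ground M by move=> y [].
apply: (cl_sub_flat fF (@subIsetl _ F (ground M))); split; first exact: EN.
by rewrite !rN //; apply: sub_ext.
Qed.

Section Spanned.
Variables (T : Type) (N M : matroid T).
Hypotheses (res : restricts_to N M) (rNM : rk N (ground N) = rk M (ground M)).
Hypothesis span : forall H, hyperplane N H -> rk N H <= rk M (H `&` ground M).
Local Notation E := (ground M).

Let EN : E `<=` ground N. Proof. by case: res. Qed.
Let rN A : A `<=` E -> rk N A = rk M A. Proof. by case: res => _; apply. Qed.
Let IE A : A `&` E `<=` E. Proof. by move=> x []. Qed.

Lemma spanned_rk H : hyperplane N H -> rk M (H `&` E) = rk N H.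
Proof.
move=> hH; apply/eqP; rewrite eqn_leq span // andbT -rN //.
by apply: rk_mono; [move=> x []|apply: hyper_ground].
Qed.

(** Trace and closure turn out to be inverse bijections between the hyperplanes of [N] and of [M],
    so both have the same dual points; by [spanned_line] the dual lines correspond as well. *)
Lemma spanned_trace H : hyperplane N H -> hyperplane M (H `&` E).
Proof.
move=> hH; split; first exact: flat_trace res (hyper_flat hH).
by rewrite spanned_rk // -rNM; apply: hyper_rk.
Qed.

Lemma spanned_cl H : hyperplane M H -> hyperplane N (cl N H).
Proof.
move=> hH; have HE := hyper_ground hH; have HN := subset_trans HE EN.
split; first exact: flat_cl.
by rewrite rk_cl // rN // rNM; apply: hyper_rk.
Qed.

Lemma spanned_cl_trace H : hyperplane M H -> cl N H `&` E = H.
Proof.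
move=> hH; have HE := hyper_ground hH; have HN := subset_trans HE EN.
apply/esym/(hyper_eq hH (spanned_trace (spanned_cl hH))).
by move=> x Hx; split; [apply: sub_cl|apply: HE].
Qed.

Lemma spanned_traceK H : hyperplane N H -> cl N (H `&` E) = H.
Proof.
move=> hH; apply: (hyper_eq (spanned_cl (spanned_trace hH)) hH).
by apply: cl_sub_flat; [apply: hyper_flat|move=> x []].
Qed.

Lemma spanned_inj H H' : hyperplane N H -> hyperplane N H' -> H `&` E = H' `&` E -> H = H'.
Proof. by move=> hH hH' e; rewrite -(spanned_traceK hH) e spanned_traceK. Qed.

Lemma spanned_lineE H H' : hypermodular M -> hyperplane N H -> hyperplane N H' -> H <> H' ->
  (rk N ((H `&` E) `&` (H' `&` E))).+2 = rk N (ground N).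
Proof.
move=> hM hH hH' HH'; rewrite rN; last by move=> x [[]].
rewrite rNM; apply: hyperI_rk => //; try exact: spanned_trace.
by move=> /(spanned_inj hH hH').
Qed.

Lemma spanned_hypermodular : hypermodular M -> hypermodular N.
Proof.
move=> hM H H' hH hH'; rewrite /modular_pair.
have [<-|HH'] := pselect (H = H'); first by rewrite setUid setIid.
have HN := hyper_ground hH; have HN' := hyper_ground hH'.
have := rk_submod HN HN'.
have IN : H `&` H' `<=` ground N by move=> x [/HN].
have := rk_mono (_ : (H `&` E) `&` (H' `&` E) `<=` H `&` H') IN.
have sub : (H `&` E) `&` (H' `&` E) `<=` H `&` H' by move=> x [[Hx _] []].
move=> /(_ sub); have := spanned_lineE hM hH hH' HH'; have := hyper_rk hH; have := hyper_rk hH'.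
rewrite (hyper_rkU hH hH' HH'); lia.
Qed.

Lemma spanned_line H H' : hypermodular M -> hyperplane N H -> hyperplane N H' -> H <> H' ->
  H `&` H' `<=` cl N ((H `&` E) `&` (H' `&` E)).
Proof.
move=> hM hH hH' HH'; apply: cl_min; first by move=> x [[Hx _] []].
  by move=> x [/(hyper_ground hH)].
have := hyperI_rk (spanned_hypermodular hM) hH hH' HH'.
have := spanned_lineE hM hH hH' HH'; lia.
Qed.

Lemma spanned_veblen : hypermodular M -> veblen N -> veblen M.
Proof.
move=> hM VN P Q R S hP hQ hR hS PR QS [I hI [PQI RSI]].
have [PQ|PQ] := pselect (P = Q); first by exists P => //; rewrite -PQ; split=> x [].
have [RS|RS] := pselect (R = S); first by exists R => //; rewrite -RS; split=> x [].
have cl_neq A B : hyperplane M A -> hyperplane M B -> A <> B -> cl N A <> cl N B.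
  by move=> hA hB AB e; apply: AB; rewrite -(spanned_cl_trace hA) e spanned_cl_trace.
have line A B : hyperplane M A -> hyperplane M B -> A <> B -> A `&` B `<=` I ->
    cl N A `&` cl N B `<=` cl N I.
  move=> hA hB AB ABI.
  apply: subset_trans (spanned_line hM (spanned_cl hA) (spanned_cl hB) (cl_neq _ _ hA hB AB)) _.
  rewrite !spanned_cl_trace //; apply: cl_mono => //.
  by apply: subset_trans EN; apply: hyper_ground.
have [|I' hI' [PRI QSI]] := VN _ _ _ _ (spanned_cl hP) (spanned_cl hQ) (spanned_cl hR) (spanned_cl hS)
    (cl_neq _ _ hP hR PR) (cl_neq _ _ hQ hS QS).
  by exists (cl N I); [apply: spanned_cl|split; apply: line].
exists (I' `&` E); first exact: spanned_trace.
have sub A : hyperplane M A -> A `<=` cl N A.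
  by move=> hA; apply: sub_cl; apply: subset_trans EN; apply: hyper_ground.
split=> x [Ax Bx].
  split; last by apply: (hyper_ground hP).
  by apply: PRI; split; apply: sub.
split; last by apply: (hyper_ground hQ).
by apply: QSI; split; apply: sub.
Qed.

End Spanned.

Lemma iso_veblen (T U : Type) (M : matroid T) (M' : matroid U) (f : T -> U) :
  set_bij (ground M) (ground M') f -> (forall X, X `<=` ground M -> rk M' (f @` X) = rk M X) ->
  veblen M' -> veblen M.
Proof.
move=> bf rf VM P Q R S hP hQ hR hS PR QS [I hI [PQI RSI]].
have img H : hyperplane M H -> hyperplane M' (f @` H).
  by move=> hH; apply/(iso_hyperplane bf rf) => //; apply: hyper_ground.
have HE H : hyperplane M H -> H `<=` ground M by apply: hyper_ground.
have IE H H' : hyperplane M H -> H `&` H' `<=` ground M by move=> hH x [/(HE _ hH)].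
have img_neq H H' : hyperplane M H -> hyperplane M H' -> H <> H' -> f @` H <> f @` H'.
  move=> hH hH' HH' e; apply: (hyper_neq hH hH' HH').
  by apply/(iso_subset bf (HE _ hH) (HE _ hH')); rewrite e.
have [|I' hI' [PRI QSI]] := VM _ _ _ _ (img _ hP) (img _ hQ) (img _ hR) (img _ hS)
    (img_neq _ _ hP hR PR) (img_neq _ _ hQ hS QS).
  exists (f @` I); first exact: img.
  rewrite -!(iso_setI bf) //; try exact: HE.
  by split; apply: image_subset.
have [I0 I0E eI] := iso_pre bf (hyper_ground hI').
move: hI' PRI QSI; rewrite eI => /(iso_hyperplane bf rf I0E) hI0.
rewrite -!(iso_setI bf) //; try exact: HE.
move=> /(iso_subset bf (IE _ _ hP) I0E) PRI /(iso_subset bf (IE _ _ hQ) I0E) QSI.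
by exists I0.
Qed.

(** * Saturated extensions *)


(* A new element is named by the family of the sets of [M] that span it; this
   bounds the number of elements and makes a maximal extension exist. *)
Section SaturatedExtension.
Variables (T : Type) (M : matroid T).
Hypothesis finM : finite_matroid M.
Local Notation E := (ground M).
Local Notation U := (T + set (set T))%type.

Definition old (x : T) : U := inl x.
Lemma old_inj : injective old. Proof. by move=> x y []. Qed.
Local Notation M0 := (push M old_inj).

Definition name_of (N : matroid U) (t : U) : set (set T) :=
  [set B | B `<=` E /\ cl N (old @` B) t].

(** The rank and hyperplane clauses keep the dual geometry of [M]. The last clause identifies a new
    element with its name, so new elements spanned by the same sets coincide. *)
Definition admissible (N : matroid U) :=
  [/\ finite_matroid N, restricts_to N M0,
      rk N (ground N) = rk M0 (ground M0),
      forall H, hyperplane N H -> rk N H <= rk M0 (H `&` ground M0) &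
      forall t, ground N t -> ground M0 t \/ t = inr (name_of N t)].

Let old_ground A : A `<=` E -> old @` A `<=` ground M0.
Proof. by move=> AE _ [x /AE Ex <-]; exists x. Qed.

Let trace_old B : B `<=` ground M0 -> exists2 A, A `<=` E & B = old @` A.
Proof.
move=> BE; exists (old @^-1` B); first exact: (@preimage_ground _ _ old M old_inj B BE).
apply/seteqP; split=> [y By|_ [x Bx <-] //].
by have [x Ex xy] := BE _ By; exists x => //; rewrite /preimage /= xy.
Qed.

Lemma admissible_M0 : admissible M0.
Proof.
split=> //.
- exact: push_finite.
- by split.
- by move=> H hH; rewrite setIidl //; apply: hyper_ground.
- by left.
Qed.

Section Step.
Variables (N : matroid U) (C : set (set U)).
Hypotheses (aN : admissible N) (cC : modular_cut N C) (C0 : C !=set0) (gC : good_cut N C).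
Hypothesis nC : ~ principal N C.

Definition cut_name : set (set T) := [set B | B `<=` E /\ C (cl N (old @` B))].
Local Notation u := (inr cut_name : U).

Let finN : finite_matroid N. Proof. by case: aN. Qed.
Let resN : restricts_to N M0. Proof. by case: aN. Qed.
Let rkN : rk N (ground N) = rk M0 (ground M0). Proof. by case: aN. Qed.
Let spanN H : hyperplane N H -> rk N H <= rk M0 (H `&` ground M0).
Proof. by case: aN => _ _ _ + _; apply. Qed.
Let M0N : ground M0 `<=` ground N. Proof. by case: resN. Qed.

Lemma cut_loops : ~ C (cl N set0).
Proof.
case: cC => Cf Cup _ CL; apply: nC; exists (cl N set0); first exact: Cf.
apply/seteqP; split=> [G CG|G [fG sub]]; last exact: (Cup _ _ CL).
by have fG := Cf _ CG; split=> //; apply: cl_sub_flat.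
Qed.

(** An element already bearing the name of the cut lies in the same hyperplanes as the cut contains,
    as these are spanned by their traces. The cut would then be generated by the closure of that
    element. *)
Lemma cut_name_new : ~ ground N u.
Proof.
move=> Nu; case: aN => _ _ _ _ /(_ _ Nu) [[x _]//|[eu]].
have nameP B : B `<=` E -> C (cl N (old @` B)) <-> cl N (old @` B) u.
  move=> BE; have := congr1 (fun D : set (set T) => D B) eu => /= eB.
  split=> [CB|uB].
    by have : cut_name B by []; rewrite eB => -[].
  by have : name_of N u B by []; rewrite /= -eB => -[].
have hyperP H : hyperplane N H -> C H <-> H u.
  move=> hH; have := spanned_traceK resN rkN spanN hH.
  have [A AE ->] := trace_old (@subIsetr _ H (ground M0)).
  by move=> <-; apply: nameP.
have uE : [set u] `<=` ground N by move=> _ ->.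
case: cC => Cf Cup _; apply: nC; exists (cl N [set u]); first exact: flat_cl.
apply/seteqP; split=> [G CG|G [fG uG]].
  have fG := Cf _ CG; split=> //; apply: (cl_sub_flat fG) => _ ->.
  apply: contrapT => Gu; have GE := flat_ground fG.
  have ncG : ~ cl N G u by move=> /(cl_sub_flat fG (@subset_refl _ _)).
  have [H [hH GH Hu]] := hyper_avoid GE Nu ncG.
  by apply: Hu; apply/hyperP => //; apply: (Cup _ _ CG) => //; apply: hyper_flat.
apply: (cut_from_hyperplanes cC C0 fG) => H hH GH; apply/hyperP => //.
by apply/GH/uG/sub_cl.
Qed.

Local Notation N' := (cut_ext cC cut_loops finN cut_name_new).

Lemma admissible_step : admissible N'.
Proof.
have res' := cut_ext_restricts cC cut_loops finN cut_name_new.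
have rk' := cut_ext_rk cC cut_loops finN cut_name_new.
have cl' := cut_ext_cl cC cut_loops finN cut_name_new.
have ground' := cut_ext_ground cC cut_loops finN cut_name_new.
have rk'N A : A `<=` ground N -> rk N' A = rk N A by case: res' => _; apply.
have rkE : rk N' (ground N') = rk N (ground N).
  rewrite ground'; have := rk' _ (@subset_refl _ _).
  rewrite asboolT; first by lia.
  have -> : cl N (ground N) = ground N by apply/seteqP; split; [apply: cl_ground|apply: sub_cl].
  exact: cut_ground.
split.
- exact: cut_ext_finite.
- case: resN => sub rN; split; first by move=> x /sub; rewrite ground'; left.
  by move=> A AE; rewrite rk'N ?rN //; apply: subset_trans AE sub.
- by rewrite rkE.
- move=> H hH; have HN : H `&` ground N `<=` ground N by move=> x [].
  have fH := flat_trace res' (hyper_flat hH).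
  have HE' := hyper_ground hH.
  have rH := hyper_rk hH; rewrite rkE in rH.
  have HM0 : H `&` ground M0 = H `&` ground N `&` ground M0.
    by rewrite -setIA (setIidr M0N).
  have Hsub : H `<=` H `&` ground N `|` [set u].
    by move=> x Hx; have := HE' _ Hx; rewrite ground' => -[]; [left|right].
  have [rHN|rHN] := leqP (rk N (ground N)) (rk N (H `&` ground N)).+1.
    have hHN : hyperplane N (H `&` ground N).
      split=> //; apply/eqP; rewrite eqn_leq rHN andbT -rH ltnS -rk'N //.
      by apply: rk_mono => // x [].
    rewrite HM0; apply: leq_trans (spanN hHN); rewrite -ltnS rH.
    exact: rHN.
  have HuE : H `&` ground N `|` [set u] `<=` ground N'.
    by rewrite ground' => x [[]|]; [left|right].
  have rkHu := rk' _ HN.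
  have := rk_mono Hsub HuE => rHu.
  have rHN2 : (rk N (H `&` ground N)).+2 = rk N (ground N) by lia.
  (* A hyperplane of the extension with a trace of corank 2 would be new. The good cut has a member
     P above that trace, and P with the new element has the rank of H and contains it, so P ⊆ H,
     although P exceeds the trace in rank. *)
  have [P [hP CP HP]] := gC fH rHN2; have PN := hyper_ground hP.
  have rP : rk N' (P `|` [set u]) <= rk N' H.
    have := rk' _ PN; rewrite asboolT; first by have := hyper_rk hP; lia.
    have -> : cl N P = P; last by [].
    by apply/seteqP; split; [apply: cl_sub_flat (hyper_flat hP) (@subset_refl _ _)|apply: sub_cl].
  have PE' : P `|` [set u] `<=` ground N' by rewrite ground' => x [/PN|]; [left|right].
  have HPu : H `<=` P `|` [set u] by move=> x /Hsub[/HP|]; [left|right].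
  have PH := flat_max (hyper_flat hH) HPu PE' rP.
  have : rk N P <= rk N (H `&` ground N).
    by apply: rk_mono => // x Px; split; [apply: PH; left|apply: PN].
  by have := hyper_rk hP; lia.
have cl'N A t : A `<=` ground N -> ground N t -> cl N' A t <-> cl N A t.
  move=> AN Nt; have AtN := sub_ext AN Nt.
  split=> -[_ e]; split=> //; first by move: e; rewrite !rk'N.
    by rewrite ground'; left.
  by rewrite !rk'N.
have oldN B : B `<=` E -> old @` B `<=` ground N.
  by move=> BE; apply: subset_trans (old_ground BE) M0N.
move=> t; rewrite ground' => -[Nt|->].
  case: aN => _ _ _ _ /(_ _ Nt) [M0t|e]; [by left|right].
  rewrite {1}e; congr inr; apply/seteqP; split=> B [BE cB]; split=> //.
    by apply/cl'N => //; apply: oldN.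
  by apply/cl'N => //; apply: oldN.
right; congr inr; apply/seteqP; split=> B [BE cB]; split=> //.
  by apply/cl' => //; apply: oldN.
by apply/cl' => //; apply: oldN.
Qed.

End Step.

(** The names range over the finite double power set of [E], so some admissible extension has a
    maximal set of names. A non-principal good cut would add one more. *)
Lemma saturated_extension : exists N, admissible N /\ saturated N.
Proof.
pose names (N : matroid U) := [set S : set (set T) | ground N (inr S)].
have [|||A [[N [aN ->]] Amax]] := @finite_maximal _ [set S | S `<=` [set B | B `<=` E]]
    [set A | exists N, admissible N /\ A = names N].
- by do 2 apply: finite_subsets.
- move=> _ [N [[_ _ _ _ nm] ->]] S NS; case: (nm _ NS) => [[x _]//|[->]] B.
  by case.
- by exists (names M0), M0; split=> //; apply: admissible_M0.
exists N; split=> // C cC C0 gC; apply: contrapT => nC.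
have aN' := admissible_step aN cC C0 gC nC.
apply: (cut_name_new aN cC C0 nC).
apply: (Amax _ (ex_intro _ _ (conj aN' erefl))) => [S|].
  by rewrite /names /= => NS; left.
by rewrite /names /mkset cut_ext_ground; right.
Qed.

End SaturatedExtension.

Definition rank4_OTE_modular := forall (T : Type) (M : matroid T),
  finite_matroid M -> rk M (ground M) = 4 -> OTE M -> modular M.

Lemma saturated_hypermodular_extension (T : Type) (M : matroid T) :
  finite_matroid M -> hypermodular M ->
  exists (U : Type) (N : matroid U), [/\ finite_matroid N, hypermodular N, saturated N,
    rk N (ground N) = rk M (ground M) & embeds M N /\ (veblen N -> veblen M)].
Proof.
move=> finM hM; have [N [[finN resN rkN spanN _] satN]] := saturated_extension finM.
have [f bf rf] := push_iso M (@old_inj T).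
have hM0 := iso_hypermodular bf rf hM.
exists (T + set (set T))%type, N; split=> //.
- exact: spanned_hypermodular resN rkN spanN hM0.
- by rewrite rkN (iso_rk_ground bf rf).
- split; first by exists (push M (@old_inj T)) => //; exists f.
  by move=> VN; apply: (iso_veblen bf rf); apply: spanned_veblen resN rkN spanN hM0 VN.
Qed.

Lemma hypermodular_veblen (T : Type) (M : matroid T) : rank4_OTE_modular ->
  finite_matroid M -> hypermodular M -> veblen M.
Proof.
move=> H4; have [n] := ubnP (rk M (ground M)); elim: n M => // n IH M rn finM hM.
have [r3|r3] := leqP (rk M (ground M)) 3; first exact: rank3_veblen.
have [r4|r4] := eqVneq (rk M (ground M)) 4.
  have [U [N [finN hN satN rN [_ VN]]]] := saturated_hypermodular_extension finM hM.
  apply: VN; apply: modular_veblen; apply: H4 => //; first by rewrite rN.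
  move=> C cC C0; have [//|gC] := rank4_good_cut hN (etrans rN r4) cC C0.
  exact: satN.
apply: kantor_step => //; first by lia.
move=> q Eq rq; apply: IH => //; last exact: contract_hypermodular.
by have := rk_contract_in Eq rq (@subset_refl _ _) Eq; rewrite /=; lia.
Qed.

Lemma hypermodular_embeds (T : Type) (M : matroid T) : rank4_OTE_modular ->
  finite_matroid M -> hypermodular M ->
  exists (U : Type) (N : matroid U), modular N /\ embeds M N.
Proof.
move=> H4 finM hM; have [U [N [finN hN satN _ [eN _]]]] := saturated_hypermodular_extension finM hM.
exists U, N; split=> //; apply: veblen_saturated_modular => //.
exact: hypermodular_veblen.
Qed.

Theorem theorem17 :
  ((forall (T : Type) (M : matroid T),
      finite_matroid M -> sticky M -> modular M) <->
   (forall (T : Type) (M : matroid T),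
      finite_matroid M -> hypermodular M ->
      exists (U : Type) (N : matroid U), modular N /\ embeds M N)) /\
  ((forall (T : Type) (M : matroid T),
      finite_matroid M -> hypermodular M ->
      exists (U : Type) (N : matroid U), modular N /\ embeds M N) <->
   (forall (T : Type) (M : matroid T),
      finite_matroid M -> OTE M -> modular M)).
Proof.
split; split.
- move=> stickyM T M; apply: hypermodular_embeds => {}T {}M finM r4 oM.
  by apply: stickyM => //; apply: OTE4_sticky.
- move=> embM T M finM sM.
  have [U [N [mN eN]]] := embM _ _ finM (sticky_hypermodular finM sM).
  exact: sticky_embed_modular sM mN eN.
- move=> embM T M finM oM.
  have [U [N [mN eN]]] := embM _ _ finM (OTE_hypermodular oM).
  exact: OTE_embed_modular oM mN eN.
- move=> oteM T M; apply: hypermodular_embeds => {}T {}M finM r4 oM.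
  exact: oteM.
Qed.
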